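(* Let $S_{m,n}$ be subsampled randomized Hadamard transform (SRHT) sketching matrices and let $U_n$ be deterministic $n\times p$ matrices with orthonormal columns, with $i$-th row denoted $U_{i:}$. If $\lim_{n\to\infty}\max_{i=1,\dots,n}\|U_{i:}\|=0$, and $m/\log^2n\to\infty$ with $\limsup m/n<1$ as $m,n\to\infty$ ($p$ fixed), then for $G=I_{p^2}+P_p+Q_p$ and $\gamma_n=m/n$, $$\sqrt{\frac m{1-\gamma_n}}\;\mathrm{vec}(U_n^\top S_{m,n}^\top S_{m,n}U_n-I_p)\Rightarrow\mathcal N(0,G).$$
   Context: $n=2^l$ ranges over powers of two, $m=m_n<n$. Hadamard matrices: $H_0=1$, $H_{t+1}=\frac1{\sqrt2}\begin{pmatrix}H_t&H_t\\H_t&-H_t\end{pmatrix}$. The SRHT sketching matrix is $S_{m,n}=\sqrt{n/m}\,BH_lD$, where $B$ is an $n\times n$ diagonal matrix with i.i.d. Bernoulli$(m/n)$ diagonal entries and $D$ is an independent $n\times n$ diagonal matrix with i.i.d. Rademacher diagonal entries. $\mathrm{vec}$ stacks the columns of a matrix, with indexing $\mathrm{vec}(A)_{(ij)}=A_{ij}$. $P_p$ is the $p^2\times p^2$ matrix $(P_p)_{(ij),(kl)}=\delta_{il}\delta_{jk}$ (matrix transposition), and $Q_p=\mathrm{vec}(I_p)\mathrm{vec}(I_p)^\top$. *)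

(* Defs.v *)
From HB Require Import structures.
From mathcomp Require Import all_boot all_order all_algebra.
From mathcomp Require Import all_classical all_reals all_analysis.

Set Implicit Arguments.
Unset Strict Implicit.
Unset Printing Implicit Defensive.

Import Order.TTheory GRing.Theory Num.Theory.
Import numFieldNormedType.Exports.

Local Open Scope classical_set_scope.
Local Open Scope ring_scope.

Section vectorization.
Variables (R : pzRingType) (p : nat).

(* The pair (i, j) sits at position j * p + i of 'I_(p * p), as columns are
   stacked; [mxvec_index] itself is row-major, whence the swap. *)
Definition vec_index (i j : 'I_p) : 'I_(p * p) := mxvec_index j i.

Definition vec_pair (a : 'I_(p * p)) : 'I_p * 'I_p :=
  let ji := enum_val (cast_ord (esym (mxvec_cast p p)) a) in (ji.2, ji.1).

Definition vec (A : 'M[R]_p) : 'cV[R]_(p * p) :=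
  \col_a A (vec_pair a).1 (vec_pair a).2.

Definition transp_mx : 'M[R]_(p * p) :=
  \matrix_(a, b) (((vec_pair a).1 == (vec_pair b).2) &&
                  ((vec_pair a).2 == (vec_pair b).1))%:R.

Lemma vec_indexK i j : vec_pair (vec_index i j) = (i, j).
Proof.
by rewrite /vec_pair /vec_index /mxvec_index cast_ordK enum_rankK.
Qed.

Lemma vecE A i j : vec A (vec_index i j) 0 = A i j.
Proof. by rewrite mxE vec_indexK. Qed.

Lemma vec_mxvec A : vec A = (mxvec A^T)^T.
Proof.
apply/colP => a; rewrite 2!mxE; case/mxvec_indexP: a => j i.
by rewrite mxvecE mxE -[mxvec_index j i]/(vec_index i j) vec_indexK.
Qed.

Lemma transp_mxE i j k l :
  transp_mx (vec_index i j) (vec_index k l) = ((i == l) && (j == k))%:R.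
Proof. by rewrite mxE !vec_indexK. Qed.

End vectorization.

Arguments transp_mx {R} p.

Definition vec_id_mx (R : pzRingType) (p : nat) : 'M[R]_(p * p) :=
  vec 1%:M *m (vec 1%:M)^T.

Definition limit_cov (R : pzRingType) (p : nat) : 'M[R]_(p * p) :=
  1%:M + transp_mx p + vec_id_mx R p.

Lemma hadamard_dim t : (2 ^ t + 2 ^ t = 2 ^ t.+1)%N.
Proof. by rewrite addnn expnS mul2n. Qed.

Fixpoint hadamard (R : rcfType) (t : nat) : 'M[R]_(2 ^ t) :=
  if t is t'.+1 then
    castmx (hadamard_dim t', hadamard_dim t')
      ((Num.sqrt 2)^-1 *: block_mx (hadamard R t') (hadamard R t')
                                   (hadamard R t') (- hadamard R t'))
  else 1%:M.

Definition row_norm (R : rcfType) (n p : nat) (U : 'M[R]_(n, p)) (i : 'I_n) : R :=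
  Num.sqrt (\sum_j U i j ^+ 2).

Section random_variables.
Context d (T : measurableType d) (R : realType) (P : probability T R).

(* For a finite family, the product rule over the whole family gives the one
   over any subfamily, by taking the remaining sets equal to [setT]. *)
Definition mutually_independent (I : finType) (X : I -> {RV P >-> R}) : Prop :=
  forall A : I -> set R, (forall i, measurable (A i)) ->
    P (\bigcap_(i in [set: I]) (X i @^-1` A i)) =
    (\prod_(i : I) P (X i @^-1` A i))%E.

(* Real-valued, hence not [bernoulli_prob], which is a law on [bool]. *)
Definition is_bernoulli (q : R) (X : {RV P >-> R}) : Prop :=
  P (X @^-1` [set 1]) = q%:E /\ P (X @^-1` [set 0]) = (1 - q)%:E.

Definition is_rademacher (X : {RV P >-> R}) : Prop :=
  P (X @^-1` [set 1]) = (2^-1)%:E /\ P (X @^-1` [set -1]) = (2^-1)%:E.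

Definition is_std_normal (X : {RV P >-> R}) : Prop :=
  forall A : set R, measurable A -> distribution P X A = normal_prob 0 1 A.

(* Z is N(0, Sigma), with Sigma possibly singular: Z = A g, with g a vector of
   independent standard normal variables and A A^T = Sigma. *)
Definition is_normal_vector (k : nat) (Sigma : 'M[R]_k) (Z : T -> 'cV[R]_k) : Prop :=
  exists (r : nat) (A : 'M[R]_(k, r)) (g : 'I_r -> {RV P >-> R}),
    [/\ mutually_independent g,
        forall i, is_std_normal (g i),
        A *m A^T = Sigma
      & forall w, Z w = A *m \col_i g i w].

Definition is_srht (l m : nat) (S : T -> 'M[R]_(2 ^ l)) : Prop :=
  exists b e : 'I_(2 ^ l) -> {RV P >-> R},
    [/\ mutually_independent
          (fun k : 'I_(2 ^ l) + 'I_(2 ^ l) =>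
             match k with inl i => b i | inr i => e i end),
        forall i, is_bernoulli (m%:R / (2 ^ l)%:R) (b i),
        forall i, is_rademacher (e i)
      & forall w, S w = Num.sqrt ((2 ^ l)%:R / m%:R) *:
          (diag_mx (\row_i b i w) *m hadamard R l *m diag_mx (\row_i e i w))].

End random_variables.

(* Each X_n may live on its own probability space. *)
Definition cvg_in_law (R : realType) (k : nat)
    (d : nat -> measure_display) (T : forall n, measurableType (d n))
    (P : forall n, probability (T n) R) (X : forall n, T n -> 'cV[R]_k)
    (d' : measure_display) (T' : measurableType d') (P' : probability T' R)
    (Z : T' -> 'cV[R]_k) : Prop :=
  forall f : 'cV[R]_k -> R, continuous f -> (exists M : R, forall x, `|f x| <= M) ->
    ('E_(P n)[f \o X n] @[n --> \oo] --> 'E_P'[f \o Z])%E.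

(* N(0, Sigma) is represented by some vector having that law; it determines
   the law, so the choice does not matter, and asking for its existence
   rules out vacuity. *)
Definition cvg_to_normal (R : realType) (k : nat)
    (d : nat -> measure_display) (T : forall n, measurableType (d n))
    (P : forall n, probability (T n) R) (X : forall n, T n -> 'cV[R]_k)
    (Sigma : 'M[R]_k) : Prop :=
  exists (d' : measure_display) (T' : measurableType d') (P' : probability T' R)
    (Z : T' -> 'cV[R]_k),
    is_normal_vector P' Sigma Z /\ cvg_in_law P X P' Z.

(* Main.v *)
Require Import Defs.
From HB Require Import structures.
From mathcomp Require Import all_boot all_order all_algebra.
From mathcomp Require Import all_classical all_reals all_analysis.
From mathcomp Require Import measurable_realfun.
From mathcomp Require Import ring lra.
From mathcomp Require Import complex.

Set Implicit Arguments.
Unset Strict Implicit.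
Unset Printing Implicit Defensive.

Import Order.TTheory GRing.Theory Num.Theory.
Import numFieldNormedType.Exports.

Local Open Scope classical_set_scope.
Local Open Scope ring_scope.

(** Write the Hadamard matrix as [n ^ (- 1 / 2)] times a matrix [h] of signs. Its
    columns are the characters of an elementary abelian 2-group: they are
    orthogonal, and closed under entrywise products ([hadamard_sign_walsh]).

    Tested against a [p] by [p] matrix [C], the scaled sketching error is a sum
    over the rows [k] of [z_k xi_k / sqrt n], where the [xi_k] are independent
    standardized Bernoulli variables and [z_k] is the value at [C] of the
    quadratic form of the [k]-th row of [h D U] ([srht_form]). The [z_k] depend
    on the signs in [D] only, which suggests conditioning on the signs.

    For fixed signs the sum is a weighted sum of independent variables. Its
    characteristic function differs from that of a Gaussian of variance
    [V = (1 / n) sum_k z_k ^ 2] by at most a multiple of the third absolute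
    moments ([bern_clt]). Rademacher sums are sub-Gaussian, so the third moments
    of the [z_k] are bounded ([fair_had_quad3]), and this error is
    [O(m ^ (- 1 / 2))] when [m / n] stays away from one ([bern_error_le]).

    It remains to see that [V] is nearly deterministic. With [M = U C U^T],
    expanding the squares and averaging over the rows keeps the terms
    [M_ij M_kl] times the four signs for which columns [i], [j] and columns [k],
    [l] have the same product. The group structure forces either one of the three
    pairings of the four indices, or four distinct indices ([pairing_split]). The
    pairings add up to [sum C_ab ^ 2 + sum C_ab C_ba + (tr C) ^ 2], up to a
    diagonal correction ([had_var_split]), and that is the quadratic form of the
    covariance in the theorem ([limit_cov_form]). The distinct indices give a
    Walsh chaos of order four. Both the correction and the mean square of the
    chaos are bounded by a multiple of the largest squared row norm of [U], which
    tends to zero ([had_var_conc]).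

    Characteristic functions and second moments are thereby controlled
    ([srht_char], [srht_tail]), and the conclusion is an instance of Levy's
    continuity theorem ([levy_continuity]). The latter rests on the approximation
    of bounded continuous functions, on boxes, by trigonometric polynomials with
    the same bound; Bernstein polynomials in sines of the coordinates provide
    these ([trigpoly_approx]). The limit vector is the image of independent
    standard normal variables under an explicit factor of the covariance
    ([gaussian_family], [limit_cov_factor]). *)

(** * Expectations over independent bits *)

Section independent_bits.
Variables (R : realType) (I : finType).
Implicit Types (w : I -> bool -> R) (F G : {ffun I -> bool} -> R).

(** The random signs, the random selection of rows and the trials of Bernstein
    approximation are all families of independent bits; as finite sums, their
    expectations raise no question of integrability. *)
Definition bexp w F : R := \sum_(b : {ffun I -> bool}) (\prod_i w i (b i)) * F b.

Definition bit_law w : Prop :=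
  (forall i b, 0 <= w i b) /\ (forall i, w i true + w i false = 1).

Lemma eq_bexp w F G : F =1 G -> bexp w F = bexp w G.
Proof. by move=> FG; apply: eq_bigr => b _; rewrite FG. Qed.

Lemma bexpD w F G : bexp w (fun b => F b + G b) = bexp w F + bexp w G.
Proof. by rewrite /bexp -big_split; apply: eq_bigr => b _; rewrite mulrDr. Qed.

Lemma bexpZ w a F : bexp w (fun b => a * F b) = a * bexp w F.
Proof. by rewrite /bexp big_distrr; apply: eq_bigr => b _; rewrite mulrCA. Qed.

Lemma bexpB w F G : bexp w (fun b => F b - G b) = bexp w F - bexp w G.
Proof. by rewrite /bexp -sumrB; apply: eq_bigr => b _; rewrite mulrBr. Qed.

Lemma bexp_sum w (J : Type) (r : seq J) (Q : pred J) (F : J -> {ffun I -> bool} -> R) :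
  bexp w (fun b => \sum_(j <- r | Q j) F j b) = \sum_(j <- r | Q j) bexp w (F j).
Proof.
rewrite /bexp exchange_big; apply: eq_bigr => b _.
by rewrite big_distrr.
Qed.

Lemma bexp_prod w (f : I -> bool -> R) :
  bexp w (fun b => \prod_i f i (b i)) =
  \prod_i (w i true * f i true + w i false * f i false).
Proof.
transitivity (\sum_(b : {ffun I -> bool}) \prod_i (w i (b i) * f i (b i))).
  by apply: eq_bigr => b _; rewrite big_split.
rewrite -(bigA_distr_bigA (fun i b => w i b * f i b)).
by apply: eq_bigr => i _; rewrite big_bool.
Qed.

Section law.
Variable w : I -> bool -> R.
Hypothesis hw : bit_law w.

Lemma bexp1 : bexp w (fun=> 1) = 1.
Proof.
transitivity (bexp w (fun b => \prod_(i : I) 1)).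
  by apply: eq_bexp => b; rewrite big1.
by rewrite (bexp_prod w (fun _ _ => 1)) big1// => i _; rewrite !mulr1 hw.2.
Qed.

Lemma bexp_cst a : bexp w (fun=> a) = a.
Proof.
rewrite -[RHS]mulr1 -[in RHS]bexp1 -bexpZ.
by apply: eq_bexp => b; rewrite mulr1.
Qed.

Lemma le_bexp F G : (forall b, F b <= G b) -> bexp w F <= bexp w G.
Proof.
move=> FG; apply: ler_sum => b _; apply: ler_wpM2l => //.
by apply: prodr_ge0 => i _; apply: hw.1.
Qed.

Lemma bexp_norm F : `|bexp w F| <= bexp w (fun b => `|F b|).
Proof.
rewrite /bexp (le_trans (ler_norm_sum _ _ _))//; apply: ler_sum => b _.
by rewrite normrM ger0_norm//; apply: prodr_ge0 => i _; apply: hw.1.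
Qed.

Lemma bexp_dist F G : `|bexp w F - bexp w G| <= bexp w (fun b => `|F b - G b|).
Proof. by rewrite -bexpB; apply: bexp_norm. Qed.

Lemma bexp_coord (i : I) (f : bool -> R) :
  bexp w (fun b => f (b i)) = w i true * f true + w i false * f false.
Proof.
have := bexp_prod w (fun j b => if j == i then f b else 1).
rewrite [RHS](bigD1 i)//= eqxx big1 ?mulr1 => [<-|j /negPf->]; last first.
  by rewrite !mulr1 hw.2.
apply: eq_bexp => b; rewrite (bigD1 i)//= eqxx big1 ?mulr1// => j /negPf->.
by [].
Qed.

Lemma bexp_coord2 (i j : I) (f g : bool -> R) : i != j ->
  bexp w (fun b => f (b i) * g (b j)) =
  (w i true * f true + w i false * f false) *
  (w j true * g true + w j false * g false).
Proof.
move=> ij; have ji : (j == i) = false by rewrite eq_sym (negPf ij).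
pose h k b := if k == i then f b else if k == j then g b else 1.
transitivity (bexp w (fun b => \prod_k h k (b k))).
  apply: eq_bexp => b; rewrite (bigD1 i)//= /h eqxx (bigD1 j) ?ji//= eqxx.
  by rewrite big1 ?mulr1// => k /andP[/negPf-> /negPf->].
rewrite bexp_prod (bigD1 i)//= /h eqxx (bigD1 j) ?ji//= eqxx.
rewrite big1 ?mulr1// => k /andP[/negPf-> /negPf->].
by rewrite !mulr1 hw.2.
Qed.

(** Independent centred variables are uncorrelated, so variances add up. *)
Lemma bexp_sqr_sum (g : I -> bool -> R) (J : finType) (c : J -> I) :
  injective c ->
  (forall i, w i true * g i true + w i false * g i false = 0) ->
  bexp w (fun b => (\sum_j g (c j) (b (c j))) ^+ 2) =
  \sum_j (w (c j) true * g (c j) true ^+ 2 + w (c j) false * g (c j) false ^+ 2).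
Proof.
move=> cinj g0.
under eq_bexp => b do rewrite expr2 big_distrlr /=.
rewrite bexp_sum; apply: eq_bigr => j _; rewrite bexp_sum (bigD1 j)//= big1.
  rewrite addr0; rewrite -(bexp_coord (c j) (fun b => g (c j) b ^+ 2)).
  by apply: eq_bexp => b; rewrite expr2.
move=> k kj; rewrite (bexp_coord2 (g (c j)) (g (c k))) ?g0 ?mul0r//.
by rewrite (inj_eq cinj) eq_sym.
Qed.

End law.
End independent_bits.

(** * Phases, trigonometric bounds and the Bernoulli central limit theorem *)

Section complex_phase.
Variable R : realType.

Definition cis (u : R) : R[i] := (cos u +i* sin u)%C.

Lemma cisD u v : cis (u + v) = cis u * cis v.
Proof. by rewrite /cis cosD sinD; congr Complex; ring. Qed.

Lemma cis0 : cis 0 = 1.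
Proof. by rewrite /cis cos0 sin0. Qed.

Lemma cis_sum (I : finType) (f : I -> R) : cis (\sum_i f i) = \prod_i cis (f i).
Proof. exact: (big_morph cis cisD cis0). Qed.

Lemma normc_cis u : ComplexField.Normc.normc (cis u) = 1.
Proof. by rewrite /= cos2Dsin2 sqrtr1. Qed.

End complex_phase.

Section trig_bounds.
Variable R : realType.
Implicit Types x y : R.

Lemma sin_MVT x y : x <= y ->
  exists2 c, x <= c <= y & sin y - sin x = cos c * (y - x).
Proof.
move=> xy; have dsin z : z \in `]x, y[ -> is_derive z 1 sin (cos z).
  by move=> _; apply: is_derive_sin.
have csin : {within `[x, y], continuous (@sin R)}.
  by apply: continuous_subspaceT => z; apply: continuous_sin.
have [c] := MVT_segment xy dsin csin.
by rewrite in_itv /= => cxy e; exists c.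
Qed.

Lemma norm_sin_le x : `|sin x| <= `|x|.
Proof.
wlog x0 : x / 0 <= x => [H|].
  case: (leP 0 x) => [|/ltW x0]; first exact: H.
  by rewrite -normrN -sinN -[leRHS]normrN H// oppr_ge0.
have [c _] := sin_MVT x0; rewrite sin0 !subr0 => ->.
by rewrite normrM ler_piMl// cos_max.
Qed.

Lemma one_sub_cos x : 1 - cos x = 2 * sin (x / 2) ^+ 2.
Proof.
have -> : cos x = cos (x / 2 + x / 2) by congr cos; field.
by rewrite cosD -!expr2 sin2cos2; ring.
Qed.

Lemma cos_ge1B x : 1 - x ^+ 2 / 2 <= cos x.
Proof.
have : sin (x / 2) ^+ 2 <= (x / 2) ^+ 2.
  by rewrite -[leLHS]real_normK ?num_real// -[leRHS]real_normK ?num_real// lerXn2r ?nnegrE// norm_sin_le.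
have := one_sub_cos x; rewrite expr_div_n; lra.
Qed.

Lemma norm_sinB x : exists2 c, `|c| <= `|x| & `|sin x - x| = `|x| * (1 - cos c).
Proof.
wlog x0 : x / 0 <= x => [H|].
  case: (leP 0 x) => [|/ltW x0]; first exact: H.
  have Nx0 : 0 <= - x by rewrite oppr_ge0.
  have [c] := H _ Nx0; by rewrite sinN -opprD !normrN => cx e; exists c.
have [c /andP[c0 cx]] := sin_MVT x0; rewrite sin0 !subr0 => ->.
exists c; first by rewrite !ger0_norm.
rewrite -[X in _ - X]mul1r -mulrBl normrM mulrC.
by rewrite -(normrN (cos c - 1)) opprB (@ger0_norm _ (1 - cos c))// subr_ge0 cos_le1.
Qed.

Lemma norm_sinB_le x : `|sin x - x| <= `|x| ^+ 3.
Proof.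
have [c cx ->] := norm_sinB x; rewrite exprS ler_wpM2l//.
have := cos_ge1B c.
have : `|c| ^+ 2 <= `|x| ^+ 2 by rewrite lerXn2r ?nnegrE.
rewrite !real_normK ?num_real//; have := sqr_ge0 x; lra.
Qed.

(** With [s = sin (x / 2)] the difference is [- 2 (s - x / 2) (s + x / 2)],
    with factors bounded by [x ^+ 2 / 4] and [`|x|]. *)
Lemma norm_cosB_le x : `|cos x - (1 - x ^+ 2 / 2)| <= `|x| ^+ 3.
Proof.
have -> : cos x - (1 - x ^+ 2 / 2) =
    - 2 * ((sin (x / 2) - x / 2) * (sin (x / 2) + x / 2)).
  have := one_sub_cos x; set s := sin _ => h.
  have -> : cos x = 1 - 2 * s ^+ 2 by lra.
  by field.
have [c cx e] := norm_sinB (x / 2).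
have x2 : `|x / 2| = `|x| / 2 by rewrite normrM normfV [X in _ / X]gtr0_norm.
have h1 : `|sin (x / 2) - x / 2| <= (`|x| / 2) ^+ 2.
  rewrite e -x2 expr2 ler_wpM2l// one_sub_cos (le_trans _ cx)//.
  have := norm_sin_le (c / 2); have := sin_max (c / 2).
  rewrite (normrM c) normfV (@ger0_norm _ 2)// -[sin _ ^+ 2]real_normK ?num_real//.
  have := normr_ge0 (sin (c / 2)); set s := `|sin _|; nra.
have h2 : `|sin (x / 2) + x / 2| <= `|x|.
  rewrite (le_trans (ler_normD _ _))//; have := norm_sin_le (x / 2).
  rewrite x2; lra.
rewrite !normrM normrN (@ger0_norm _ 2)//.
have : `|sin (x / 2) - x / 2| * `|sin (x / 2) + x / 2| <= (`|x| / 2) ^+ 2 * `|x|.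
  exact: ler_pM.
have : 0 <= `|x| ^+ 3 by rewrite exprn_ge0.
rewrite expr_div_n -[`|x| ^+ 2 / _ * _]mulrAC -exprSr; lra.
Qed.

End trig_bounds.

Section phase_products.
Variables (R : realType) (I : finType).
Import ComplexField.Normc.

Lemma normc_real (x : R) : normc x%:C%C = `|x|.
Proof. by rewrite /= expr0n /= addr0 sqrtr_sqr. Qed.

Lemma normc_ge0 (z : R[i]) : 0 <= normc z.
Proof. by case: z => a b; apply: sqrtr_ge0. Qed.

Lemma norm_Re_le (z : R[i]) : `|complex.Re z| <= normc z.
Proof.
by case: z => a b /=; rewrite -sqrtr_sqr ler_wsqrtr// lerDl sqr_ge0.
Qed.

Lemma normc_le_ReIm (z : R[i]) : normc z <= `|complex.Re z| + `|complex.Im z|.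
Proof.
case: z => a b /=; rewrite -[leRHS]ger0_norm ?addr_ge0// -sqrtr_sqr ler_wsqrtr//.
rewrite sqrrD !real_normK ?num_real// -addrA [_ *+ 2 + _]addrC addrA lerDl.
by rewrite mulrn_wge0// mulr_ge0.
Qed.

Lemma normc_prod_le1 (r : seq I) (a : I -> R[i]) :
  (forall i, normc (a i) <= 1) -> normc (\prod_(i <- r) a i) <= 1.
Proof.
move=> a1; elim: r => [|i r IH]; first by rewrite big_nil normc1.
by rewrite big_cons normcM mulr_ile1// normc_ge0.
Qed.

(** The factors are replaced one at a time; those that remain have modulus at
    most one and do not amplify the error. *)
Lemma normc_prodB_le (r : seq I) (a b : I -> R[i]) :
  (forall i, normc (a i) <= 1) -> (forall i, normc (b i) <= 1) ->
  normc (\prod_(i <- r) a i - \prod_(i <- r) b i) <=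
  \sum_(i <- r) normc (a i - b i).
Proof.
move=> a1 b1; elim: r => [|i r IH].
  by rewrite !big_nil subrr normc0.
rewrite !big_cons; set A := \prod_(_ <- _) _; set B := \prod_(_ <- _) _.
have -> : a i * A - b i * B = (a i - b i) * A + b i * (A - B) by ring.
rewrite (le_trans (le_normcD _ _))// !normcM lerD//.
- by rewrite ler_piMr ?normc_ge0// normc_prod_le1.
- by rewrite (le_trans _ IH)// ler_piMl ?normc_ge0.
Qed.

Variable w : I -> bool -> R.

Definition bit_char (u : I -> bool -> R) i : R[i] :=
  (w i true)%:C%C * cis (u i true) + (w i false)%:C%C * cis (u i false).

(** A cosine is the real part of a phase, and distributivity turns the mean of
    a product of independent phases into the product of their means. *)
Lemma bexp_cos (u : I -> bool -> R) (t : R) :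
  bexp w (fun b => cos (\sum_i u i (b i) + t)) =
  complex.Re (cis t * \prod_i bit_char u i).
Proof.
transitivity (complex.Re (cis t *
    \prod_i \sum_(b : bool) (w i b)%:C%C * cis (u i b))); last first.
  by congr (complex.Re (_ * _)); apply: eq_bigr => i _; rewrite big_bool.
rewrite (bigA_distr_bigA (fun i b => (w i b)%:C%C * cis (u i b))) big_distrr /=.
rewrite (raddf_sum (@complex.Re R)); apply: eq_bigr => b _.
rewrite big_split -cis_sum -rmorph_prod.
set p := \prod_i w i (b i); set v := \sum_i _.
by rewrite mulrCA -cisD addrC /= mul0r subr0.
Qed.

End phase_products.

Section bernoulli_char.
Variables (R : realType) (q : R).
Hypotheses (q0 : 0 < q) (q1 : q < 1).
Import ComplexField.Normc.

Definition bern_law (b : bool) : R := if b then q else 1 - q.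

Definition bern_sd : R := Num.sqrt (q * (1 - q)).

Definition bern_std (b : bool) : R := (b%:R - q) / bern_sd.

Lemma bern_sd_gt0 : 0 < bern_sd.
Proof. by rewrite sqrtr_gt0 mulr_gt0// subr_gt0. Qed.

Lemma bern_sdE : bern_sd ^+ 2 = q * (1 - q).
Proof. by rewrite sqr_sqrtr// mulr_ge0 ?subr_ge0// ltW. Qed.

Lemma bern_std_mean :
  bern_law true * bern_std true + bern_law false * bern_std false = 0.
Proof. by rewrite /bern_law /bern_std /=; field; rewrite gt_eqF// bern_sd_gt0. Qed.

Lemma bern_std_var :
  bern_law true * bern_std true ^+ 2 + bern_law false * bern_std false ^+ 2 = 1.
Proof.
rewrite /bern_law /bern_std /= !expr_div_n bern_sdE; field.
by rewrite subr_eq0 !(gt_eqF, eq_sym 1, lt_eqF).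
Qed.

Lemma bern_std_bound b : `|bern_std b| <= bern_sd^-1.
Proof.
have s0 := bern_sd_gt0.
rewrite /bern_std normrM normfV (gtr0_norm s0) ler_piMl//.
  by rewrite invr_ge0 ltW.
by case: b => /=; rewrite ler_norml; apply/andP; split; move: q0 q1; lra.
Qed.

(** One of the three factors is taken out with its uniform bound; the other two
    leave the variance, which is one. *)
Lemma bern_std_abs3 :
  bern_law true * `|bern_std true| ^+ 3 + bern_law false * `|bern_std false| ^+ 3
  <= bern_sd^-1.
Proof.
have h b : `|bern_std b| ^+ 3 <= bern_sd^-1 * bern_std b ^+ 2.
  by rewrite exprS real_normK ?num_real// ler_wpM2r ?sqr_ge0// bern_std_bound.
rewrite -[leRHS]mulr1 -bern_std_var mulrDr (mulrCA _ (bern_law true)) (mulrCA _ (bern_law false)).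
by apply: lerD; rewrite ler_wpM2l//= ?subr_ge0 ltW.
Qed.

Lemma expRN_quad (s : R) : 0 <= s -> `|expR (- s) - (1 - s)| <= s ^+ 2.
Proof.
move=> s0; have h1 := expR_ge1Dx (- s); have h2 := expR_ge1Dx s.
have h3 : expR (- s) * expR s = 1 by rewrite mulrC expRxMexpNx_1.
have h4 := expR_gt0 (- s).
rewrite ger0_norm; last by lra.
have h5 : expR (- s) * (1 + s) <= 1 by rewrite -[leRHS]h3 ler_wpM2l// ltW.
suff : expR (- s) <= 1 - s + s ^+ 2 by lra.
have s1 : 0 < 1 + s by lra.
rewrite -(ler_pM2r s1) (le_trans h5)//.
have -> : (1 - s + s ^+ 2) * (1 + s) = 1 + s ^+ 3 by ring.
by rewrite lerDl exprn_ge0.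
Qed.

(** Mean zero and variance one make the two characteristic functions agree to
    second order in [s]; the third absolute moment bounds the remainder. *)
Lemma bern_char_bound (s : R) :
  normc ((bern_law true)%:C%C * cis (s * bern_std true) +
         (bern_law false)%:C%C * cis (s * bern_std false) -
         (expR (- (s ^+ 2 / 2)))%:C%C) <=
  3 * (bern_sd^-1 + 1) * `|s| ^+ 3.
Proof.
have s0 := bern_sd_gt0.
have m0 := bern_std_mean; have v1 := bern_std_var; have m3 := bern_std_abs3.
have p0 : 0 <= bern_law true by rewrite /= ltW.
have p1 : 0 <= bern_law false by rewrite /= subr_ge0 ltW.
have pS : bern_law true + bern_law false = 1 by rewrite /=; ring.
move: m0 v1 m3 p0 p1 pS.
set p := bern_law true; set p' := bern_law false.
set a := bern_std true; set a' := bern_std false.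
move: p p' a a' => p p' a a' m0 v1 m3 p0 p1 pS.
rewrite (le_trans (normc_le_ReIm _))//=.
rewrite !(mul0r, addr0, subr0, oppr0) /=.
have hc : `|p * cos (s * a) + p' * cos (s * a') - (1 - s ^+ 2 / 2)| <=
    bern_sd^-1 * `|s| ^+ 3.
  have -> : 1 - s ^+ 2 / 2 = p * (1 - (s * a) ^+ 2 / 2) + p' * (1 - (s * a') ^+ 2 / 2).
    transitivity ((p + p') - s ^+ 2 * (p * a ^+ 2 + p' * a' ^+ 2) / 2).
      by rewrite pS v1 mulr1.
    by field.
  have -> : p * cos (s * a) + p' * cos (s * a') -
     (p * (1 - (s * a) ^+ 2 / 2) + p' * (1 - (s * a') ^+ 2 / 2)) =
     p * (cos (s * a) - (1 - (s * a) ^+ 2 / 2)) +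
     p' * (cos (s * a') - (1 - (s * a') ^+ 2 / 2)) by ring.
  rewrite (le_trans (ler_normD _ _))// !normrM (ger0_norm p0) (ger0_norm p1).
  rewrite (@le_trans _ _ (p * `|s * a| ^+ 3 + p' * `|s * a'| ^+ 3))//.
    by rewrite lerD// ler_wpM2l// norm_cosB_le.
  rewrite !normrM !exprMn !(mulrCA _ (`|s| ^+ 3)) -mulrDr [leLHS]mulrC.
  by rewrite ler_wpM2r// ?exprn_ge0.
have hs : `|p * sin (s * a) + p' * sin (s * a')| <= bern_sd^-1 * `|s| ^+ 3.
  have -> : p * sin (s * a) + p' * sin (s * a') =
    p * (sin (s * a) - s * a) + p' * (sin (s * a') - s * a').
    rewrite -[LHS]subr0 -(mulr0 s) -m0; ring.
  rewrite (le_trans (ler_normD _ _))// !normrM (ger0_norm p0) (ger0_norm p1).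
  rewrite (@le_trans _ _ (p * `|s * a| ^+ 3 + p' * `|s * a'| ^+ 3))//.
    by rewrite lerD// ler_wpM2l// norm_sinB_le.
  rewrite !normrM !exprMn !(mulrCA _ (`|s| ^+ 3)) -mulrDr [leLHS]mulrC.
  by rewrite ler_wpM2r// ?exprn_ge0.
have he : `|expR (- (s ^+ 2 / 2)) - (1 - s ^+ 2 / 2)| <= `|s| ^+ 3.
  have x0 : 0 <= s ^+ 2 / 2 by rewrite divr_ge0// sqr_ge0.
  have h1 := expRN_quad x0.
  have e1 : expR (- (s ^+ 2 / 2)) <= 1 by rewrite expR_le1 oppr_le0.
  have e2 := expR_ge1Dx (- (s ^+ 2 / 2)).
  have e0 := ltW (expR_gt0 (- (s ^+ 2 / 2))).
  have n0 := normr_ge0 s.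
  have sn : s ^+ 2 = `|s| ^+ 2 by rewrite real_normK ?num_real.
  move: h1 e1 e2 e0 x0; rewrite sn; set e := expR _; set n := `|s| in n0 *.
  move=> h1 e1 e2 e0 x0; have [n1|n1] := leP n 1.
    rewrite (le_trans h1)// expr_div_n -exprM.
    have : n ^+ 4 <= n ^+ 3 by rewrite exprSr ler_piMr// exprn_ge0.
    have : 0 <= n ^+ 4 by rewrite exprn_ge0.
    rewrite /=; lra.
  rewrite ger0_norm; last by lra.
  have : n ^+ 2 <= n ^+ 3 by rewrite [leRHS]exprSr ler_peMr ?exprn_ge0// ltW.
  lra.
have -> : p * cos (s * a) + p' * cos (s * a') - expR (- (s ^+ 2 / 2)) =
  (p * cos (s * a) + p' * cos (s * a') - (1 - s ^+ 2 / 2)) -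
  (expR (- (s ^+ 2 / 2)) - (1 - s ^+ 2 / 2)) by ring.
set A := _ - (1 - _) in hc *; set B := _ - (1 - _) in he *.
have h1 := ler_normB A B.
have t0 : 0 <= `|s| ^+ 3 by rewrite exprn_ge0.
have t1 : 0 <= bern_sd^-1 * `|s| ^+ 3 by rewrite mulr_ge0// invr_ge0 ltW.
move: hc hs he h1 t0 t1; set X := `|A|; set Y := `|B|; set Z := `|A - B|.
set S := `|_ + _|; set t := `|s| ^+ 3; set v := bern_sd^-1; lra.
Qed.

End bernoulli_char.

Section lyapunov.
Variables (R : realType) (I : finType) (q : R).
Hypotheses (q0 : 0 < q) (q1 : q < 1).
Import ComplexField.Normc.

Lemma bern_bit_law : bit_law (fun (_ : I) => bern_law q).
Proof.
split=> [i [] /=|i]; rewrite ?subr_ge0 1?ltW//.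
by rewrite /bern_law addrC subrK.
Qed.

(** Lyapunov's central limit theorem with a rate: the characteristic function
    is compared factor by factor with that of a Gaussian of the same variance,
    each factor costing the cube of its weight. *)
Lemma bern_clt (s : I -> R) (t : R) :
  `|bexp (fun=> bern_law q) (fun b => cos (\sum_i s i * bern_std q (b i) + t)) -
    cos t * expR (- ((\sum_i s i ^+ 2) / 2))| <=
  3 * ((bern_sd q)^-1 + 1) * \sum_i `|s i| ^+ 3.
Proof.
rewrite (bexp_cos _ (fun i b => s i * bern_std q b)).
set a := bit_char _ _; pose g i : R[i] := (expR (- (s i ^+ 2 / 2)))%:C%C.
have -> : cos t * expR (- ((\sum_i s i ^+ 2) / 2)) = complex.Re (cis t * \prod_i g i).
  rewrite -rmorph_prod /= mulr0 subr0; congr (_ * _).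
  by rewrite -expR_sum mulr_suml -sumrN.
rewrite -(raddfB (@complex.Re R)) -mulrBr (le_trans (norm_Re_le _))//.
rewrite normcM normc_cis mul1r (le_trans (normc_prodB_le _ _ _))//.
- move=> i; rewrite /a /bit_char (le_trans (le_normcD _ _))//.
  rewrite !normcM !normc_cis !mulr1 !normc_real !ger0_norm; last 2 first.
  + by rewrite /= subr_ge0 ltW.
  + by rewrite /= ltW.
  by rewrite /= addrC subrK.
- by move=> i; rewrite normc_real ger0_norm ?expR_ge0// expR_le1 oppr_le0 divr_ge0// sqr_ge0.
rewrite mulr_sumr; apply: ler_sum => i _.
exact: bern_char_bound.
Qed.

End lyapunov.

(** * Rademacher signs and Walsh functions *)

Section rademacher.
Variables (R : realType) (I : finType).

Definition fair : I -> bool -> R := fun _ _ => 2^-1.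

Definition sgb (b : bool) : R := (-1) ^+ b.

Definition walsh (A : {set I}) (b : {ffun I -> bool}) : R := \prod_(i in A) sgb (b i).

Lemma fair_law : bit_law fair.
Proof.
by split=> [i b|i]; rewrite /fair ?invr_ge0//; field.
Qed.

Lemma sgb_sqr b : sgb b * sgb b = 1.
Proof. by case: b; rewrite /sgb /= ?expr1 ?expr0 ?mulrNN mulr1. Qed.

Lemma fair_walsh A B :
  bexp fair (fun b => walsh A b * walsh B b) = (A == B)%:R.
Proof.
pose f i b := (if i \in A then sgb b else 1) * (if i \in B then sgb b else 1).
transitivity (bexp fair (fun b => \prod_i f i (b i))).
  apply: eq_bexp => b; rewrite /walsh /f big_split /=.
  by congr (_ * _); rewrite big_mkcond.
rewrite bexp_prod /fair; have [AB|/eqP AB] := eqVneq A B.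
  by rewrite big1// => i _; rewrite /f AB; case: ifP => _; rewrite ?sgb_sqr; field.
have [i iAB] : exists i, (i \in A) != (i \in B).
  apply/existsP; apply: contra_notT AB; rewrite negb_exists => /forallP h.
  by apply/setP => i; apply/eqP; have := h i; rewrite negbK.
rewrite (bigD1 i)//= [X in X * _](_ : _ = 0) ?mul0r//.
by rewrite /f; move: iAB; case: (i \in A); case: (i \in B) => //= _;
  rewrite /sgb expr1 expr0; ring.
Qed.

(** Distinct Walsh functions are orthonormal; grouping the terms that carry
    the same one costs a factor equal to the size of the largest group. *)
Lemma fair_walsh_sum_sqr (Q : finType) (S : Q -> {set I}) (c : Q -> R) (K : nat) :
  (forall A, #|[pred q | (S q == A) && (c q != 0%R)]| <= K)%N ->
  bexp fair (fun b => (\sum_q c q * walsh (S q) b) ^+ 2) <=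
  K%:R * \sum_q c q ^+ 2.
Proof.
move=> hK.
have -> : bexp fair (fun b => (\sum_q c q * walsh (S q) b) ^+ 2) =
    \sum_q \sum_r c q * c r * (S q == S r)%:R.
  under eq_bexp => b do rewrite expr2 big_distrlr /=.
  rewrite bexp_sum; apply: eq_bigr => q _; rewrite bexp_sum; apply: eq_bigr => r _.
  by rewrite -fair_walsh -bexpZ; apply: eq_bexp => b; ring.
(* Each pair of terms carrying the same Walsh function is split evenly by
   [2 u v <= u ^+ 2 + v ^+ 2]; the factor [c r != 0] restricts the count of
   such pairs to the one bounded by [K]. *)
pose e q r : R := (S q == S r)%:R * (c r != 0)%:R * (c q ^+ 2 / 2).
have h q r : c q * c r * (S q == S r)%:R <= e q r + e r q.
  rewrite /e [S r == S q]eq_sym; case: (S q == S r); last first.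
    by rewrite !mul0r mulr0 addr0.
  rewrite !mul1r mulr1; have [->|r0] := eqVneq (c r) 0.
    by rewrite mulr0 mul0r add0r expr0n mul0r mulr0.
  have [->|q0] := eqVneq (c q) 0.
    by rewrite mul0r mul0r addr0 expr0n mul0r mulr0.
  by rewrite !mul1r; have := sqr_ge0 (c q - c r); rewrite sqrrB; lra.
rewrite (@le_trans _ _ (\sum_q \sum_r (e q r + e r q)))//.
  by apply: ler_sum => q _; apply: ler_sum => r _; apply: h.
have hs : \sum_q \sum_r e q r <= K%:R / 2 * \sum_q c q ^+ 2.
  rewrite mulr_sumr; apply: ler_sum => q _; rewrite /e -mulr_suml.
  rewrite [leRHS]mulrAC -mulrA; apply: ler_wpM2r; first by rewrite divr_ge0// sqr_ge0.
  rewrite (eq_bigr (fun r => ((S r == S q) && (c r != 0))%:R)); last first.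
    by move=> r _; rewrite [S r == _]eq_sym -natrM mulnb.
  rewrite -natr_sum ler_nat (leq_trans _ (hK (S q)))// -sum1_card.
  by rewrite [leqRHS]big_mkcond leq_sum// => r _; rewrite inE; case: (_ && _).
under eq_bigr => q _ do rewrite big_split /=.
rewrite big_split /= [X in _ + X]exchange_big /=; move: hs; lra.
Qed.

Lemma fair_cosh_prod (c : I -> R) :
  bexp fair (fun b => expR (\sum_i c i * sgb (b i))) =
  \prod_i ((expR (c i) + expR (- c i)) / 2).
Proof.
transitivity (bexp fair (fun b => \prod_i expR (c i * sgb (b i)))).
  by apply: eq_bexp => b; rewrite expR_sum.
rewrite (bexp_prod _ (fun i b => expR (c i * sgb b))).
apply: eq_bigr => i _; rewrite /fair /sgb expr1 expr0 mulrN1 mulr1.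
by field.
Qed.

(** [expR x <= (1 - x)^-1] and its reflection bound the mean by
    [(1 - x ^+ 2)^-1], which is at most [1 + 2 * x ^+ 2] on this range. *)
Lemma cosh_le (x : R) : `|x| <= 2^-1 -> (expR x + expR (- x)) / 2 <= expR (2 * x ^+ 2).
Proof.
move=> x2; have : - 2^-1 <= x <= 2^-1 by rewrite -ler_norml.
move=> /andP[xl xu].
have h1 := expR_ge1Dx x; have h2 := expR_ge1Dx (- x).
have h3 : expR x * expR (- x) = 1 := expRxMexpNx_1 x.
have h4 := expR_ge1Dx (2 * x ^+ 2).
rewrite (le_trans _ h4)//.
have x20 := sqr_ge0 x.
have x24 : x ^+ 2 <= 2^-1 ^+ 2 by rewrite -[x ^+ 2]real_normK ?num_real// lerXn2r ?nnegrE// invr_ge0.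
have a1 : expR x * (1 - x) <= 1 by rewrite -[leRHS]h3 ler_wpM2l ?expR_ge0.
have a2 : expR (- x) * (1 + x) <= 1 by rewrite -[leRHS]h3 [leRHS]mulrC ler_wpM2l ?expR_ge0.
have p0 : 0 < (1 - x) * (1 + x) by apply: mulr_gt0; lra.
rewrite -(ler_pM2r p0).
have b1 : expR x * (1 - x) * (1 + x) <= 1 + x by rewrite -[leRHS]mul1r ler_wpM2r//; lra.
have b2 : expR (- x) * (1 + x) * (1 - x) <= 1 - x by rewrite -[leRHS]mul1r ler_wpM2r//; lra.
have -> : (expR x + expR (- x)) / 2 * ((1 - x) * (1 + x)) =
   (expR x * (1 - x) * (1 + x) + expR (- x) * (1 + x) * (1 - x)) / 2 by field.
apply: (@le_trans _ _ 1); first by lra.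
have -> : (1 + 2 * x ^+ 2) * ((1 - x) * (1 + x)) = 1 + x ^+ 2 * (1 - 2 * x ^+ 2) by ring.
rewrite lerDl mulr_ge0//.
move: x24; rewrite (_ : 2^-1 ^+ 2 = 4^-1 :> R); last by field.
lra.
Qed.

Definition exp6_cst : R := 2 ^+ 6 * 6`!%:R.

Lemma exp6_cst_ge0 : 0 <= exp6_cst.
Proof. by rewrite mulr_ge0 ?ler0n// exprn_ge0. Qed.

(** The argument is halved on the right so that the weights met in
    [fair_moment6] fall within the range of [cosh_le]. *)
Lemma pow6_le_expR (y : R) : y ^+ 6 <= exp6_cst * (expR (y / 2) + expR (- (y / 2))).
Proof.
have pos (x : R) : 0 <= x -> x ^+ 6 <= exp6_cst * expR (x / 2).
  move=> x0; have x20 : 0 <= x / 2 by rewrite divr_ge0.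
  have := expR_ge1Dxn 5 x20; rewrite /exp6_cst.
  have : 0 < 6`!%:R :> R by rewrite ltr0n fact_gt0.
  move: (6`!%:R) => K K0; set e := expR _ => h.
  have -> : x ^+ 6 = 2 ^+ 6 * (x / 2) ^+ 6 by rewrite -exprMn; congr (_ ^+ _); field.
  rewrite -mulrA ler_wpM2l ?exprn_ge0// [leRHS]mulrC -ler_pdivrMr//.
  by rewrite (le_trans _ h)// lerDr ler01.
have [y0|y0] := leP 0 y.
  by rewrite (le_trans (pos _ y0))// ler_wpM2l ?exp6_cst_ge0// lerDl expR_ge0.
have Ny0 : 0 <= - y by rewrite oppr_ge0 ltW.
have := pos _ Ny0; rewrite exprNn -signr_odd expr0 mul1r mulNr => /le_trans; apply.
by rewrite ler_wpM2l ?exp6_cst_ge0// lerDr expR_ge0.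
Qed.

Definition mom6 : R := exp6_cst * (2 * expR 1).

Lemma mom6_ge0 : 0 <= mom6.
Proof. by rewrite mulr_ge0 ?exp6_cst_ge0// mulr_ge0// expR_ge0. Qed.

(** Rademacher sums are sub-Gaussian: the sixth power is dominated by
    exponentials, whose means factor over the signs. *)
Lemma fair_moment6 (c : I -> R) : \sum_i c i ^+ 2 <= 1 ->
  bexp fair (fun b => (\sum_i c i * sgb (b i)) ^+ 6) <= mom6.
Proof.
move=> c1; have law := fair_law.
have half (d : I -> R) : (forall i, d i ^+ 2 = c i ^+ 2 / 4) ->
    bexp fair (fun b => expR (\sum_i d i * sgb (b i))) <= expR 1.
  move=> dc; rewrite fair_cosh_prod.
  apply: (@le_trans _ _ (\prod_i expR (2 * d i ^+ 2))).
    apply: ler_prod => i _; rewrite divr_ge0 ?addr_ge0 ?expR_ge0//=.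
    apply: cosh_le; have ci1 : c i ^+ 2 <= 1.
      rewrite (le_trans _ c1)// (bigD1 i)//= lerDl sumr_ge0// => j _; exact: sqr_ge0.
    have : `|d i| ^+ 2 <= (2^-1) ^+ 2.
      by rewrite real_normK ?num_real// dc (_ : 2^-1 ^+ 2 = 4^-1 :> R); [lra|field].
    by rewrite ler_pXn2r ?nnegrE// invr_ge0.
  rewrite -expR_sum ler_expR -mulr_sumr.
  under eq_bigr do rewrite dc; rewrite -mulr_suml; move: c1; set s := \sum_i _.
  have : 0 <= s by rewrite sumr_ge0// => j _; exact: sqr_ge0.
  by lra.
rewrite (@le_trans _ _ (bexp fair (fun b => exp6_cst *
   (expR (\sum_i (c i / 2) * sgb (b i)) + expR (\sum_i (- (c i / 2)) * sgb (b i))))))//.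
  apply: le_bexp => // b.
  have := pow6_le_expR (\sum_i c i * sgb (b i)); rewrite mulr_suml -sumrN.
  under [X in _ * (expR X + _)]eq_bigr do rewrite mulrAC.
  by under [X in _ * (_ + expR X)]eq_bigr do rewrite mulrAC -mulNr.
rewrite bexpZ bexpD /mom6 ler_wpM2l ?exp6_cst_ge0// mulr_natl mulr2n lerD//; apply: half => i.
  by field.
by field.
Qed.

End rademacher.

(** * Quadratic forms in the rows of a Walsh system *)

Section walsh_system.
Variables (R : realType) (n : nat) (h : 'M[R]_n) (d : 'I_n -> 'I_n -> 'I_n).

(** The columns of [h] are distinct characters of an elementary abelian
    2-group, and [d] is the group law on their indices. *)
Definition walsh_system : Prop :=
  [/\ forall k i, h k i * h k i = 1,
      forall i j, \sum_k h k i * h k j = n%:R * (i == j)%:R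
    & forall i j k, h k i * h k j = h k (d i j)].

Hypothesis hW : walsh_system.

Lemma walsh_sqr k i : h k i * h k i = 1. Proof. by case: hW. Qed.

Lemma walsh_col_inj i j : (forall k, h k i = h k j) -> i = j.
Proof.
move=> hij; case: hW => _ /(_ i j) + _.
under eq_bigr => k _ do rewrite -hij walsh_sqr.
rewrite sumr_const card_ord; have [//|_] := eqVneq i j.
move=> /eqP; rewrite mulr0 pnatr_eq0 => /eqP n0.
by have := ltn_ord i; rewrite [X in (_ < X)%N]n0.
Qed.

Lemma walsh_opP i j a b :
  (forall k, h k i * h k j = h k a * h k b) <-> d i j = d a b.
Proof.
case: hW => _ _ hd; split=> [e|e k]; last by rewrite !hd e.
by apply: walsh_col_inj => k; rewrite -!hd.
Qed.

Lemma walsh_opC i j : d i j = d j i.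
Proof. by apply/walsh_opP => k; rewrite mulrC. Qed.

Lemma walsh_opI i j b : (d i j == d i b) = (j == b).
Proof.
apply/eqP/eqP => [/walsh_opP e|->//]; apply: walsh_col_inj => k.
by rewrite -[LHS]mul1r -[RHS]mul1r -(walsh_sqr k i) -!mulrA e.
Qed.

Lemma walsh_op_diag i a b : (d i i == d a b) = (a == b).
Proof.
apply/eqP/eqP => [/walsh_opP e|->]; last by apply/walsh_opP => k; rewrite !walsh_sqr.
apply: walsh_col_inj => k; rewrite -[LHS]mulr1 -(walsh_sqr k b) mulrA -e walsh_sqr.
by rewrite mul1r.
Qed.

End walsh_system.

Section quadratic_forms.
Variables (R : realType) (n p : nat) (h : 'M[R]_n) (d : 'I_n -> 'I_n -> 'I_n).
Variables (U : 'M[R]_(n, p)) (C : 'M[R]_p).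
Hypothesis hW : walsh_system h d.
Hypothesis U_orth : U^T *m U = 1%:M.
Implicit Types (b : {ffun 'I_n -> bool}) (k i j : 'I_n) (r s : 'I_n * 'I_n).

Let sg := @sgb R.
Let M : 'M[R]_n := U *m C *m U^T.

(** Entry [a] of row [k] of [h D U], with [D] the diagonal matrix of signs. *)
Definition had_lin k b (a : 'I_p) : R := \sum_i h k i * U i a * sg (b i).

Definition had_quad k b : R := \sum_a \sum_a' C a a' * (had_lin k b a * had_lin k b a').

Definition had_var b : R := n%:R^-1 * \sum_k had_quad k b ^+ 2.

(** The quadratic form of the limiting covariance at the vectorization of [C],
    by [limit_cov_form]. *)
Definition goe_var : R :=
  \sum_a \sum_a' C a a' ^+ 2 + \sum_a \sum_a' C a a' * C a' a + (\tr C) ^+ 2.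

Let csum : R := \sum_a \sum_a' `|C a a'|.
Let rho i : R := \sum_a U i a ^+ 2.

Let sg2 r b : R := sg (b r.1) * sg (b r.2).
Let Mr r : R := M r.1 r.2.
Let dr r := d r.1 r.2.

(** The product of two columns of [h] is a third column, so the row [k] enters
    only through the entries of [h], with coefficients [M] common to all rows. *)
Lemma had_quadE k b : had_quad k b = \sum_r h k (dr r) * (Mr r * sg2 r b).
Proof.
rewrite -(pair_bigA _ (fun i j => h k (d i j) * (M i j * (sg (b i) * sg (b j))))) /=.
transitivity (\sum_i \sum_j \sum_a \sum_a' C a a' *
   ((h k i * U i a * sg (b i)) * (h k j * U j a' * sg (b j)))).
  rewrite /had_quad; under eq_bigr => a _ do under eq_bigr => a' _ do
    rewrite /had_lin big_distrlr /= mulr_sumr.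
  under eq_bigr => a _ do rewrite exchange_big /=.
  rewrite exchange_big /=; apply: eq_bigr => i _.
  under eq_bigr => a _ do under eq_bigr => a' _ do rewrite mulr_sumr.
  under eq_bigr => a _ do rewrite exchange_big /=.
  by rewrite exchange_big.
apply: eq_bigr => i _; apply: eq_bigr => j _.
case: hW => _ _ <-.
have -> : M i j = \sum_a \sum_a' C a a' * (U i a * U j a').
  rewrite /M mxE; under eq_bigr => a' _ do rewrite !mxE mulr_suml.
  rewrite exchange_big /=; apply: eq_bigr => a _; apply: eq_bigr => a' _; ring.
rewrite mulr_suml mulr_sumr; apply: eq_bigr => a _.
rewrite mulr_suml mulr_sumr; apply: eq_bigr => a' _; ring.
Qed.

(** By orthogonality of the columns, averaging over the rows keeps the pairs of
    index pairs with the same column product. *)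
Lemma had_varE b : (0 < n)%N ->
  had_var b = \sum_r \sum_s (dr r == dr s)%:R * (Mr r * Mr s * (sg2 r b * sg2 s b)).
Proof.
move=> n0; rewrite /had_var; under eq_bigr => k _ do
  rewrite had_quadE expr2 big_distrlr /=.
rewrite exchange_big /= mulr_sumr; apply: eq_bigr => r _.
rewrite exchange_big /= mulr_sumr; apply: eq_bigr => s _.
rewrite (eq_bigr (fun k => (h k (dr r) * h k (dr s)) *
   (Mr r * Mr s * (sg2 r b * sg2 s b)))); last by move=> k _; ring.
rewrite -mulr_suml; case: hW => _ -> _; rewrite [LHS]mulrA [_^-1 * (_ * _)]mulrA mulVf ?mul1r//.
by rewrite pnatr_eq0 -lt0n.
Qed.

Let alldiff r s := uniq [:: r.1; r.2; s.1; s.2].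

(** When two column products agree and two of the four indices coincide,
    cancellation in the group matches the other two as well: short of four
    distinct indices, only the three pairings occur. *)
Lemma pairing_split r s b :
  (dr r == dr s)%:R * (sg2 r b * sg2 s b) =
  (r.1 == r.2)%:R * (s.1 == s.2)%:R +
  (r.1 != r.2)%:R * ((s == r)%:R + (s == (r.2, r.1))%:R) +
  ((dr r == dr s) && alldiff r s)%:R * (sg2 r b * sg2 s b).
Proof.
rewrite /alldiff /dr /sg2; case: r s => [i j] [a c] /=.
rewrite !inE !xpair_eqE !negb_or.
have sq x : sg (b x) * sg (b x) = 1 by apply: sgb_sqr.
have [<-|ij] := eqVneq i j.
  rewrite (walsh_op_diag hW) /= andbF !mul0r !addr0 mul1r.
  have [<-|//] := eqVneq a c; last by rewrite !mul0r.
  by rewrite !sq !mul1r.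
rewrite mul0r add0r mul1r.
have [<-|ac] := eqVneq a c.
  have -> : (d i j == d a a) = false.
    by rewrite eq_sym (walsh_op_diag hW); exact: negbTE.
  have -> : (a == i) && (a == j) = false.
    by apply/negP => /andP[/eqP-> /eqP e]; rewrite e eqxx in ij.
  have -> : (a == j) && (a == i) = false.
    by apply/negP => /andP[/eqP-> /eqP e]; rewrite e eqxx in ij.
  by rewrite !mul0r !addr0.
have [->|ai] := eqVneq a i.
  rewrite (walsh_opI hW) /= (negbTE ij) /= andbF mul0r !addr0.
  rewrite [j == c]eq_sym; have [->|] := eqVneq c j; last by rewrite mul0r.
  by rewrite mul1r mulrACA !sq mul1r.
have [->|aj] := eqVneq a j.
  rewrite (walsh_opC hW i j) (walsh_opI hW) /= ?andbF mul0r addr0 add0r.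
  rewrite [i == c]eq_sym; have [->|] := eqVneq c i; last by rewrite mul0r.
  by rewrite mul1r [sg (b j) * _]mulrC mulrACA !sq mul1r.
rewrite /= !add0r.
have [->|ci] := eqVneq i c.
  rewrite (walsh_opC hW a c) (walsh_opI hW) /=.
  by rewrite [j == a]eq_sym (negbTE aj) !mul0r.
have [->|cj] := eqVneq j c.
  rewrite (walsh_opC hW a c) (walsh_opC hW i c) (walsh_opI hW) /=.
  by rewrite [i == a]eq_sym (negbTE ai) !mul0r.
by rewrite /= andbT.
Qed.

Let Q := (('I_n * 'I_n) * ('I_n * 'I_n))%type.

Let quad_supp (q : Q) : {set 'I_n} :=
  (q.1.1 |: (q.1.2 |: (q.2.1 |: [set q.2.2])))%SET.

Let quad_coef (q : Q) : R :=
  ((dr q.1 == dr q.2) && alldiff q.1 q.2)%:R * (Mr q.1 * Mr q.2).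

Definition had_chaos b : R := \sum_q quad_coef q * walsh R (quad_supp q) b.

Lemma quad_walsh q b : alldiff q.1 q.2 ->
  walsh R (quad_supp q) b = sg2 q.1 b * sg2 q.2 b.
Proof.
case: q => [[i j] [a c]]; rewrite /alldiff /= !inE !negb_or andbT.
move=> /and3P[/and3P[ij ia ic] /andP[ja jc] ac].
rewrite /walsh /quad_supp /sg2 /= !big_setU1 ?big_set1 ?inE ?negb_or ?ij ?ia ?ja//.
by rewrite -!mulrA.
Qed.

Lemma tr_quad : \tr M = \tr C.
Proof. by rewrite /M -mulmxA mxtrace_mulC -mulmxA U_orth mulmx1. Qed.

Lemma sum_mul_tr m (A B : 'M[R]_m) : \sum_i \sum_j A i j * B j i = \tr (A *m B).
Proof. by rewrite /mxtrace; apply: eq_bigr => i _; rewrite mxE. Qed.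

Lemma sum_sqr_quad : \sum_i \sum_j M i j ^+ 2 = \sum_a \sum_a' C a a' ^+ 2.
Proof.
have e m (A : 'M[R]_m) : \sum_i \sum_j A i j ^+ 2 = \tr (A *m A^T).
  rewrite -sum_mul_tr; apply: eq_bigr => i _; apply: eq_bigr => j _.
  by rewrite mxE expr2.
rewrite !e /M !trmx_mul trmxK !mulmxA mxtrace_mulC.
rewrite !mulmxA U_orth mul1mx -(mulmxA C) U_orth mulmx1.
by rewrite mxtrace_mulC.
Qed.

Lemma sum_swap_quad : \sum_i \sum_j M i j * M j i = \sum_a \sum_a' C a a' * C a' a.
Proof.
rewrite !sum_mul_tr /M !mulmxA mxtrace_mulC !mulmxA U_orth mul1mx.
by rewrite -(mulmxA C) U_orth mulmx1.
Qed.

(** The three pairings give the three terms of the limiting variance, except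
    that they overlap on the diagonal, where the term [M i i ^+ 2] would be
    counted three times instead of once. *)
Lemma had_var_split b : (0 < n)%N ->
  had_var b = goe_var - 2 * \sum_i M i i ^+ 2 + had_chaos b.
Proof.
move=> n0; rewrite had_varE//.
pose A r s := (r.1 == r.2)%:R * (s.1 == s.2)%:R * (Mr r * Mr s).
pose B r s := (r.1 != r.2)%:R * ((s == r)%:R + (s == (r.2, r.1))%:R) * (Mr r * Mr s).
transitivity (\sum_r \sum_s A r s + \sum_r \sum_s B r s + had_chaos b).
  rewrite /had_chaos -(pair_bigA _ (fun r s => quad_coef (r, s) * walsh R (quad_supp (r, s)) b)) /=.
  rewrite -!big_split; apply: eq_bigr => r _ /=.
  rewrite -!big_split; apply: eq_bigr => s _ /=.
  have -> : quad_coef (r, s) * walsh R (quad_supp (r, s)) b = Mr r * Mr s *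
      (((dr r == dr s) && alldiff r s)%:R * (sg2 r b * sg2 s b)).
    rewrite /quad_coef /=; have [rs|_] := boolP (alldiff r s); last first.
      by rewrite andbF !mul0r mulr0.
    by rewrite (@quad_walsh (r, s))//=; ring.
  rewrite mulrCA pairing_split /A /B.
  set x1 := (r.1 == r.2)%:R; set x2 := (s.1 == s.2)%:R; set x3 := (r.1 != r.2)%:R.
  set x4 := (s == r)%:R; set x5 := (s == _)%:R; set x6 := (_ && _)%:R; ring.
congr (_ + _); rewrite /goe_var -tr_quad -sum_sqr_quad -sum_swap_quad.
have -> : \sum_r \sum_s A r s = (\tr M) ^+ 2.
  rewrite expr2; have e : \tr M = \sum_r (r.1 == r.2)%:R * Mr r.
    rewrite -(pair_bigA _ (fun i j => (i == j)%:R * M i j)) /=.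
    apply: eq_bigr => i _; rewrite (bigD1 i)//= eqxx mul1r big1 ?addr0// => j.
    by rewrite eq_sym => /negbTE->; rewrite mul0r.
  rewrite e big_distrlr /=; apply: eq_bigr => r _; apply: eq_bigr => s _.
  by rewrite /A; ring.
have -> : \sum_r \sum_s B r s =
    \sum_i \sum_j (i != j)%:R * (M i j ^+ 2 + M i j * M j i).
  rewrite [RHS](pair_bigA _ (fun i j => (i != j)%:R * (M i j ^+ 2 + M i j * M j i))) /=.
  apply: eq_bigr => r _; rewrite /B; under eq_bigr => s _ do rewrite mulrDr mulrDl.
  rewrite big_split mulrDr /=; congr (_ + _).
    rewrite (bigD1 r)//= eqxx mulr1 big1 ?addr0 ?expr2// => s /negbTE->.
    by rewrite mulr0 mul0r.
  rewrite (bigD1 (r.2, r.1))//= eqxx mulr1 big1 ?addr0 ?expr2// => s /negbTE->.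
  by rewrite mulr0 mul0r.
have -> : \sum_i \sum_j (i != j)%:R * (M i j ^+ 2 + M i j * M j i) =
   \sum_i \sum_j M i j ^+ 2 + \sum_i \sum_j M i j * M j i - 2 * \sum_i M i i ^+ 2.
  rewrite -big_split mulr_sumr -sumrB /=; apply: eq_bigr => i _.
  rewrite -big_split /= (bigD1 i)//= eqxx mul0r add0r [in RHS](bigD1 i)//=.
  rewrite (eq_bigr (fun j => M i j ^+ 2 + M i j * M j i)); first by ring.
  by move=> j; rewrite eq_sym => ->; rewrite mul1r.
ring.
Qed.

Variable eta : R.
Hypothesis rho_le : forall i, rho i <= eta.

Lemma rho_ge0 i : 0 <= rho i.
Proof. by apply: sumr_ge0 => a _; exact: sqr_ge0. Qed.

Lemma csum_ge0 : 0 <= csum.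
Proof. by apply: sumr_ge0 => a _; apply: sumr_ge0. Qed.

Lemma col_norm a : \sum_i U i a ^+ 2 = 1.
Proof.
have := congr1 (fun A : 'M[R]_p => A a a) U_orth; rewrite !mxE eqxx => e.
by apply: etrans e; apply: eq_bigr => i _; rewrite mxE expr2.
Qed.

Lemma sum_rho : \sum_i rho i = p%:R.
Proof.
rewrite /rho exchange_big /=; under eq_bigr do rewrite col_norm.
by rewrite sumr_const card_ord.
Qed.

Lemma quad_entry_le i j : M i j ^+ 2 <= csum ^+ 2 * (rho i * rho j).
Proof.
have hU k a : `|U k a| <= Num.sqrt (rho k).
  rewrite -sqrtr_sqr ler_wsqrtr// /rho (bigD1 a)//= lerDl.
  by apply: sumr_ge0 => a' _; exact: sqr_ge0.
have h1 : `|M i j| <= csum * (Num.sqrt (rho i) * Num.sqrt (rho j)).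
  rewrite /M mxE (le_trans (ler_norm_sum _ _ _))//.
  under eq_bigr => a' _ do rewrite !mxE mulr_suml.
  rewrite (@le_trans _ _ (\sum_a' \sum_a `|U i a * C a a' * U j a'|))//.
    by apply: ler_sum => a' _; exact: ler_norm_sum.
  rewrite exchange_big /csum mulr_suml; apply: ler_sum => a _.
  rewrite mulr_suml; apply: ler_sum => a' _.
  by rewrite !normrM mulrAC mulrC ler_wpM2l// ler_pM.
rewrite -[leLHS]real_normK ?num_real//.
rewrite -(sqr_sqrtr (rho_ge0 i)) -(sqr_sqrtr (rho_ge0 j)) -!exprMn.
by rewrite lerXn2r ?nnegrE// !mulr_ge0 ?csum_ge0 ?sqrtr_ge0.
Qed.

Lemma sum_diag_le : \sum_i M i i ^+ 2 <= csum ^+ 2 * eta * p%:R.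
Proof.
rewrite -sum_rho mulr_sumr; apply: ler_sum => i _.
rewrite (le_trans (quad_entry_le i i))// -mulrA ler_wpM2l ?sqr_ge0//.
by rewrite ler_wpM2r ?rho_ge0.
Qed.

Lemma sum_quad_le : \sum_r Mr r ^+ 2 <= csum ^+ 2 * p%:R ^+ 2.
Proof.
rewrite -sum_rho (expr2 (\sum_i rho i)) big_distrlr /= mulr_sumr.
rewrite -(pair_bigA _ (fun i j => M i j ^+ 2)) /=; apply: ler_sum => i _.
rewrite mulr_sumr; apply: ler_sum => j _; exact: quad_entry_le.
Qed.

(** Once the first index is chosen, cancellation leaves at most one second
    index with the prescribed column product; this is what gains a factor
    [eta] over [sum_quad_le]. *)
Lemma sum_line_le e : \sum_r (e == dr r)%:R * Mr r ^+ 2 <= csum ^+ 2 * eta * p%:R.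
Proof.
rewrite -(pair_bigA _ (fun i j => (e == d i j)%:R * M i j ^+ 2)) /=.
rewrite -sum_rho mulr_sumr; apply: ler_sum => i _.
have [[j /eqP ej]|ne] := pselect (exists j, e == d i j); last first.
  rewrite big1 => [|j _]; last first.
    by case: eqVneq => [ej|]; [case: ne; exists j; apply/eqP|rewrite mul0r].
  have eta0 := le_trans (rho_ge0 i) (rho_le i).
  by rewrite mulr_ge0 ?rho_ge0// mulr_ge0 ?sqr_ge0.
rewrite (bigD1 j)//= {1}ej eqxx mul1r big1 ?addr0 => [|k kj]; last first.
  by rewrite {1}ej (walsh_opI hW) eq_sym (negbTE kj) mul0r.
rewrite (le_trans (quad_entry_le i j))// -mulrA ler_wpM2l ?sqr_ge0//.
by rewrite mulrC ler_wpM2r ?rho_ge0.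
Qed.

(** A set of four indices is the support of at most [4 ^ 4 = 256] quadruples,
    which bounds the multiplicity of each Walsh function. *)
Lemma fair_chaos_sqr :
  bexp (@fair R 'I_n) (fun b => had_chaos b ^+ 2) <=
  256 * ((csum ^+ 2 * p%:R ^+ 2) * (csum ^+ 2 * eta * p%:R)).
Proof.
rewrite (le_trans (@fair_walsh_sum_sqr R 'I_n Q quad_supp quad_coef 256 _))//.
  move=> A; pose B := finset.setX (finset.setX A A) (finset.setX A A).
  have [A4|A4] := leqP #|A| 4; last first.
    rewrite eq_card0// => q; rewrite !inE; apply/negP => /andP[/eqP qA _].
    move: A4; rewrite -qA ltnNge => /negP; apply.
    by rewrite /quad_supp !cardsU1 cards1; do ![case: (_ \notin _)].
  apply: (@leq_trans #|B|).
    apply/subset_leq_card/fintype.subsetP => -[[i j] [a c]]; rewrite !inE /= => /andP[/eqP <- _].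
    by rewrite /quad_supp /= !inE !eqxx !orbT.
  rewrite /B !cardsX; move: A4.
  by case: #|A| => [|[|[|[|[|]]]]].
rewrite ler_wpM2l//.
rewrite (@le_trans _ _ (\sum_r \sum_s Mr r ^+ 2 * ((dr r == dr s)%:R * Mr s ^+ 2)))//.
  rewrite pair_bigA /=; apply: ler_sum => q _; rewrite /quad_coef !exprMn.
  rewrite mulrCA ler_wpM2l ?sqr_ge0//.
    rewrite ler_wpM2r ?sqr_ge0//.
  by case: (dr q.1 == dr q.2); case: alldiff; rewrite /= ?expr1n ?expr0n ?lexx ?ler01.
under eq_bigr do rewrite -mulr_sumr.
apply: (@le_trans _ _ (\sum_r Mr r ^+ 2 * (csum ^+ 2 * eta * p%:R))).
  by apply: ler_sum => r _; rewrite ler_wpM2l ?sqr_ge0// sum_line_le.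
rewrite -mulr_suml ler_wpM2r ?sum_quad_le//.
by rewrite (le_trans _ sum_diag_le)// sumr_ge0// => i _; exact: sqr_ge0.
Qed.

(** The diagonal correction and the chaos in [had_var_split] both carry a
    factor [eta], so the conditional variance concentrates when no row of [U]
    is large. *)
Lemma had_var_conc : (0 < n)%N ->
  bexp (@fair R 'I_n) (fun b => (had_var b - goe_var) ^+ 2) <=
  2 * (2 * (csum ^+ 2 * eta * p%:R)) ^+ 2 +
  512 * ((csum ^+ 2 * p%:R ^+ 2) * (csum ^+ 2 * eta * p%:R)).
Proof.
move=> n0; have law := @fair_law R 'I_n.
pose D := \sum_i M i i ^+ 2.
have D0 : 0 <= D by apply: sumr_ge0 => i _; exact: sqr_ge0.
rewrite (@le_trans _ _ (bexp (@fair R 'I_n) (fun b => 2 * (2 * D) ^+ 2 + 2 * had_chaos b ^+ 2)))//.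
  apply: le_bexp => // b; rewrite had_var_split// -/D.
  have -> : goe_var - 2 * D + had_chaos b - goe_var = had_chaos b - 2 * D by ring.
  by have := sqr_ge0 (had_chaos b + 2 * D); rewrite sqrrD sqrrB; lra.
have := fair_chaos_sqr; have := sum_diag_le; rewrite -/D.
move: (csum ^+ 2 * eta * p%:R) => K DK hc; have K0 := le_trans D0 DK.
rewrite bexpD bexp_cst// bexpZ; apply: lerD.
  by rewrite ler_wpM2l// lerXn2r ?nnegrE ?mulr_ge0// ler_wpM2l.
have -> : 512 = 2 * 256 :> R by rewrite -natrM.
by rewrite -[leRHS]mulrA ler_wpM2l.
Qed.

(** Each of the [q ^ 3] products of three entries is at most the sum of their
    cubes. *)
Lemma sum_pow3 (q : nat) (x : 'I_q -> R) : (forall a, 0 <= x a) ->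
  (\sum_a x a) ^+ 3 <= 3 * q%:R ^+ 2 * \sum_a x a ^+ 3.
Proof.
move=> x0; have tri (u v w : R) : 0 <= u -> 0 <= v -> 0 <= w ->
    u * (v * w) <= u ^+ 3 + v ^+ 3 + w ^+ 3.
  have cube (s t : R) : 0 <= s -> 0 <= t -> s <= t -> s ^+ 3 <= t ^+ 3.
    by move=> s0 t0 st; rewrite lerXn2r.
  move=> u0 v0 w0; pose m := Num.max u (Num.max v w).
  have um : u <= m by rewrite /m le_max lexx.
  have vm : v <= m by rewrite /m !le_max lexx !orbT.
  have wm : w <= m by rewrite /m !le_max lexx !orbT.
  have m0 := le_trans u0 um.
  have u3 := exprn_ge0 3 u0; have v3 := exprn_ge0 3 v0; have w3 := exprn_ge0 3 w0.
  have m3 : m ^+ 3 <= u ^+ 3 + v ^+ 3 + w ^+ 3.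
    by rewrite /m /Num.max; do ![case: ifP => _]; lra.
  rewrite (le_trans _ m3)// !exprS expr0 mulr1.
  by rewrite ler_pM// ?mulr_ge0// ler_pM.
have -> : (\sum_a x a) ^+ 3 = \sum_a \sum_b \sum_c x a * (x b * x c).
  rewrite exprS expr2 big_distrlr /= mulr_suml; apply: eq_bigr => a _.
  by rewrite mulr_sumr; apply: eq_bigr => b _; rewrite mulr_sumr.
apply: (@le_trans _ _ (\sum_a \sum_b \sum_c (x a ^+ 3 + x b ^+ 3 + x c ^+ 3))).
  apply: ler_sum => a _; apply: ler_sum => b _; apply: ler_sum => c _; exact: tri.
have cst (y : R) : \sum_(a : 'I_q) y = q%:R * y.
  by rewrite sumr_const card_ord mulr_natl.
under eq_bigr => a _.
  under eq_bigr => b _ do rewrite big_split /= cst.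
  rewrite big_split /= cst -mulr_sumr big_split /= cst.
  over.
rewrite big_split /= cst -!mulr_sumr big_split /= cst -mulr_sumr.
set S := \sum_i _; lra.
Qed.

Definition had_moment3 : R := csum ^+ 3 * (3 * p%:R ^+ 2 * (p%:R * mom6 R)).

(** The form is dominated by the squared norm of the row, whose entries are
    Rademacher sums of variance one. *)
Lemma fair_had_quad3 k :
  bexp (@fair R 'I_n) (fun b => `|had_quad k b| ^+ 3) <= had_moment3.
Proof.
have law := @fair_law R 'I_n.
apply: (@le_trans _ _ (bexp (@fair R 'I_n) (fun b =>
   csum ^+ 3 * (3 * p%:R ^+ 2 * \sum_a had_lin k b a ^+ 6)))).
  apply: le_bexp => // b; pose Y := \sum_a had_lin k b a ^+ 2.
  have hY : `|had_quad k b| <= csum * Y.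
    rewrite /csum mulr_suml (le_trans (ler_norm_sum _ _ _))//; apply: ler_sum => a _.
    rewrite mulr_suml (le_trans (ler_norm_sum _ _ _))//; apply: ler_sum => a' _.
    rewrite normrM ler_wpM2l//.
    have Y1 c : had_lin k b c ^+ 2 <= Y.
      by rewrite /Y (bigD1 c)//= lerDl sumr_ge0// => e _; exact: sqr_ge0.
    have := Y1 a; have := Y1 a'.
    rewrite normrM -(real_normK (num_real (had_lin k b a))).
    rewrite -(real_normK (num_real (had_lin k b a'))).
    have := sqr_ge0 (`|had_lin k b a| - `|had_lin k b a'|); rewrite sqrrB; lra.
  have Y0 : 0 <= Y by apply: sumr_ge0 => a _; exact: sqr_ge0.
  rewrite (@le_trans _ _ ((csum * Y) ^+ 3))//.
    by rewrite lerXn2r ?nnegrE// mulr_ge0// csum_ge0.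
  rewrite exprMn ler_wpM2l ?exprn_ge0 ?csum_ge0//.
  rewrite (le_trans (sum_pow3 _))//; first by move=> a; exact: sqr_ge0.
  by under eq_bigr do rewrite -exprM.
rewrite !bexpZ ler_wpM2l ?exprn_ge0 ?csum_ge0// ler_wpM2l ?mulr_ge0 ?exprn_ge0//.
rewrite bexp_sum -[X in X%:R * mom6 R]card_ord mulr_natl -sumr_const; apply: ler_sum => a _.
apply: fair_moment6; rewrite -(col_norm a); apply: ler_sum => i _.
by rewrite exprMn expr2 (walsh_sqr hW) mul1r.
Qed.

End quadratic_forms.

(** * Hadamard matrices and the quenched central limit theorem *)

Section hadamard_walsh.
Variable R : realType.

(** Rescaled so that the entries are [1] and [- 1]. *)
Definition hadamard_sign (l : nat) : 'M[R]_(2 ^ l) :=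
  Num.sqrt (2 ^ l)%:R *: hadamard R l.

Lemma hadamard_signS l :
  hadamard_sign l.+1 = castmx (hadamard_dim l, hadamard_dim l)
    (block_mx (hadamard_sign l) (hadamard_sign l)
              (hadamard_sign l) (- hadamard_sign l)).
Proof.
have castZ m n (e : m = n) (a : R) (A : 'M[R]_m) :
    castmx (e, e) (a *: A) = a *: castmx (e, e) A.
  by case: n / e; rewrite !castmx_id.
rewrite /hadamard_sign [hadamard R l.+1]/= -!scalerN -!scale_block_mx !castZ scalerA.
congr (_ *: _).
by rewrite expnS natrM sqrtrM// mulrAC divff ?mul1r.
Qed.

Lemma walsh_system_cast m n (e : m = n) (h : 'M[R]_m) :
  (exists d, walsh_system h d) -> exists d, walsh_system (castmx (e, e) h) d.
Proof. by case: n / e; rewrite castmx_id. Qed.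

(** Doubling adjoins one generator of order two to the group of columns: the
    half in which an index lies records that generator. *)
Lemma walsh_system_double n (h : 'M[R]_n) d : walsh_system h d ->
  exists d', walsh_system (block_mx h h h (- h)) d'.
Proof.
have splitl i : fintype.split (lshift n i) = inl i :> 'I_n + 'I_n by exact: (unsplitK (inl i)).
have splitr i : fintype.split (rshift n i) = inr i :> 'I_n + 'I_n by exact: (unsplitK (inr i)).
case=> h1 h2 h3; exists (fun i j => match fintype.split i, fintype.split j with
  | inl i, inl j => lshift n (d i j) | inl i, inr j => rshift n (d i j)
  | inr i, inl j => rshift n (d i j) | inr i, inr j => lshift n (d i j) end).
split=> [k i|i j|i j k].
- case: (split_ordP k) => k' ->; case: (split_ordP i) => i' ->;
    by rewrite ?block_mxEul ?block_mxEur ?block_mxEdl ?block_mxEdr ?mxE ?mulrNN h1.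
- rewrite big_split_ord /=.
  case: (split_ordP i) => i' ->; case: (split_ordP j) => j' ->;
    rewrite ?eq_lshift ?eq_rshift ?eq_lrshift ?eq_rlshift.
  + under eq_bigr do rewrite !block_mxEul.
    under [X in _ + X]eq_bigr do rewrite !block_mxEdl.
    by rewrite h2 natrD mulrDl.
  + under eq_bigr do rewrite block_mxEul block_mxEur.
    under [X in _ + X]eq_bigr do rewrite block_mxEdl block_mxEdr mxE mulrN.
    by rewrite sumrN subrr mulr0.
  + under eq_bigr do rewrite block_mxEul block_mxEur.
    under [X in _ + X]eq_bigr do rewrite block_mxEdl block_mxEdr mxE mulNr.
    by rewrite sumrN subrr mulr0.
  + under eq_bigr do rewrite !block_mxEur.
    under [X in _ + X]eq_bigr do rewrite !block_mxEdr !mxE mulrNN.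
    by rewrite h2 natrD mulrDl.
- case: (split_ordP i) => i' ->; case: (split_ordP j) => j' ->;
  rewrite ?splitl ?splitr; case: (split_ordP k) => k' ->;
  by rewrite ?block_mxEul ?block_mxEur ?block_mxEdl ?block_mxEdr ?mxE ?mulrNN ?mulrN ?mulNr h3.
Qed.

Lemma hadamard_sign_walsh l : exists d, walsh_system (hadamard_sign l) d.
Proof.
elim: l => [|l [d hd]].
  exists (fun i _ => i); rewrite /hadamard_sign /= sqrtr1 scale1r.
  by split=> [k i|i j|i j k]; rewrite ?big_ord1 !mxE !ord1 ?eqxx ?mulr1.
rewrite hadamard_signS; apply: walsh_system_cast.
exact: walsh_system_double hd.
Qed.

End hadamard_walsh.

Section conditional_clt.
Variables (R : realType) (n p : nat) (h : 'M[R]_n) (d : 'I_n -> 'I_n -> 'I_n).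
Variables (U : 'M[R]_(n, p)) (C : 'M[R]_p) (q eta : R).
Hypotheses (hW : walsh_system h d) (U_orth : U^T *m U = 1%:M).
Hypotheses (n0 : (0 < n)%N) (q0 : 0 < q) (q1 : q < 1).
Hypothesis eta_le : forall i, \sum_a U i a ^+ 2 <= eta.

Let z k (e : {ffun 'I_n -> bool}) : R := had_quad h U C k e / Num.sqrt n%:R.

Definition abs_sum : R := \sum_a \sum_a' `|C a a'|.

Definition conc_bound : R :=
  2 * (2 * (abs_sum ^+ 2 * eta * p%:R)) ^+ 2 +
  512 * ((abs_sum ^+ 2 * p%:R ^+ 2) * (abs_sum ^+ 2 * eta * p%:R)).

Let Ee := bexp (@fair R 'I_n).
Let Eb := bexp (fun _ : 'I_n => bern_law q).
Let lawe := @fair_law R 'I_n.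
Let lawb := @bern_bit_law R 'I_n q q0 q1.

Let sum_sqr_z e : \sum_k z k e ^+ 2 = had_var h U C e.
Proof.
rewrite /had_var mulr_sumr; apply: eq_bigr => k _.
by rewrite expr_div_n sqr_sqrtr ?ler0n// mulrC.
Qed.

Lemma had_var_ge0 e : 0 <= had_var h U C e.
Proof. by rewrite -sum_sqr_z sumr_ge0// => k _; exact: sqr_ge0. Qed.

Lemma goe_var_ge0 : 0 <= goe_var C.
Proof.
have : 0 <= \sum_a \sum_a' (C a a' + C a' a) ^+ 2.
  by apply: sumr_ge0 => a _; apply: sumr_ge0 => a' _; exact: sqr_ge0.
have -> : \sum_a \sum_a' (C a a' + C a' a) ^+ 2 =
   2 * (\sum_a \sum_a' C a a' ^+ 2 + \sum_a \sum_a' C a a' * C a' a).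
  transitivity (\sum_a \sum_a' C a a' ^+ 2 + 2 * \sum_a \sum_a' C a a' * C a' a +
                \sum_a \sum_a' C a' a ^+ 2).
    rewrite mulr_sumr -!big_split; apply: eq_bigr => a _ /=.
    by rewrite mulr_sumr -!big_split; apply: eq_bigr => a' _ /=; ring.
  by rewrite [X in _ + X]exchange_big /=; ring.
have := sqr_ge0 (\tr C); rewrite /goe_var; lra.
Qed.

Lemma expR_lip (x y : R) : 0 <= x -> 0 <= y -> `|expR (- x) - expR (- y)| <= `|x - y|.
Proof.
wlog xy : x y / x <= y => [H x0 y0|x0 y0].
  case: (leP x y) => [xy|/ltW yx]; first exact: H.
  by rewrite distrC (distrC x); exact: H.
have h1 := expR_ge1Dx (x - y).
have -> : expR (- y) = expR (- x) * expR (x - y) by rewrite -expRD; congr expR; ring.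
rewrite -[X in X - _]mulr1 -mulrBr normrM ger0_norm ?expR_ge0//.
have e1 : expR (- x) <= 1 by rewrite expR_le1 oppr_le0.
have e2 : expR (x - y) <= 1 by rewrite expR_le1 subr_le0.
rewrite ger0_norm ?subr_ge0// (distrC x) (@ger0_norm _ (y - x)) ?subr_ge0//.
rewrite (@le_trans _ _ (1 - expR (x - y)))//; last by lra.
by rewrite ler_piMl// subr_ge0.
Qed.

(** For fixed signs, [bern_clt] compares the mean over the selection with a
    Gaussian of variance [had_var]. The inequality [x <= tau + x ^+ 2 / tau]
    then turns the mean square deviation of that variance into a bound for the
    error of replacing it by its limit. *)
Lemma srht_char_bound (t tau : R) : 0 < tau ->
  `|Ee (fun e => Eb (fun b => cos (\sum_k z k e * bern_std q (b k) + t))) -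
    cos t * expR (- (goe_var C / 2))| <=
  3 * ((bern_sd q)^-1 + 1) * (had_moment3 C / Num.sqrt n%:R) + (tau + conc_bound / tau).
Proof.
move=> tau0; have sd0 := bern_sd_gt0 q0 q1.
have sn0 : 0 < Num.sqrt (n%:R : R) by rewrite sqrtr_gt0 ltr0n.
rewrite -{1}[cos t * _](bexp_cst lawe) (le_trans (bexp_dist lawe _ _))//.
pose V := had_var h U C.
apply: (@le_trans _ _ (Ee (fun e => 3 * ((bern_sd q)^-1 + 1) * \sum_k `|z k e| ^+ 3 +
   (tau + tau^-1 * (V e - goe_var C) ^+ 2)))).
  apply: (le_bexp lawe) => e.
  have h1 := bern_clt q0 q1 (z ^~ e) t; rewrite sum_sqr_z -/(V e) in h1.
  set X := bexp _ _ in h1 *; set Y := cos t * expR (- (V e / 2)) in h1.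
  set W := cos t * _.
  have -> : X - W = (X - Y) + (Y - W) by ring.
  rewrite (le_trans (ler_normD _ _))// lerD//.
  rewrite /Y /W -mulrBr normrM.
  apply: (@le_trans _ _ (`|V e / 2 - goe_var C / 2|)).
    rewrite (le_trans _ (expR_lip _ _)) ?divr_ge0 ?had_var_ge0 ?goe_var_ge0//.
    by rewrite ler_piMl// cos_max.
  rewrite -mulrBl normrM (@ger0_norm _ 2^-1) ?invr_ge0//.
  rewrite -(real_normK (num_real (V e - _))); set x := `|_|.
  have x0 : 0 <= x by exact: normr_ge0.
  have : 0 <= tau^-1 * (x - tau) ^+ 2 by rewrite mulr_ge0 ?sqr_ge0// invr_ge0 ltW.
  have -> : tau^-1 * (x - tau) ^+ 2 = tau^-1 * x ^+ 2 - 2 * x + tau.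
    by field; rewrite gt_eqF.
  lra.
rewrite /Ee bexpD bexpZ bexpD bexp_cst// bexpZ; apply: lerD.
  apply: ler_wpM2l; first by rewrite mulr_ge0// addr_ge0// invr_ge0 ltW.
  rewrite bexp_sum.
  apply: (@le_trans _ _ (\sum_(k < n) had_moment3 C / Num.sqrt n%:R ^+ 3)).
    apply: ler_sum => k _.
    have -> : bexp (@fair R 'I_n) (fun e => `|z k e| ^+ 3) =
        Num.sqrt n%:R ^- 3 * bexp (@fair R 'I_n) (fun e => `|had_quad h U C k e| ^+ 3).
      rewrite -bexpZ; apply: eq_bexp => e.
      by rewrite /z normrM exprMn mulrC normfV (gtr0_norm sn0) exprVn.
    rewrite [leRHS]mulrC ler_wpM2l ?invr_ge0 ?exprn_ge0 ?(ltW sn0)//.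
    exact: (fair_had_quad3 C hW U_orth).
  rewrite sumr_const card_ord -[leLHS]mulr_natr.
  have := sqr_sqrtr (ler0n R n); move: sn0; set s := Num.sqrt _ => sn0 <-.
  by rewrite le_eqVlt; apply/orP; left; apply/eqP; field; rewrite gt_eqF.
rewrite lerD2l [leRHS]mulrC ler_wpM2l ?invr_ge0 ?(ltW tau0)//.
exact: (had_var_conc C hW U_orth eta_le n0).
Qed.

(** For fixed signs the second moment is [had_var], which exceeds [goe_var] by
    at most one plus the square of the deviation. *)
Lemma srht_second_moment :
  Ee (fun e => Eb (fun b => (\sum_k z k e * bern_std q (b k)) ^+ 2)) <=
  goe_var C + 1 + conc_bound.
Proof.
apply: (@le_trans _ _ (Ee (fun e => goe_var C + 1 + (had_var h U C e - goe_var C) ^+ 2))).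
  apply: (le_bexp lawe) => e.
  have -> : Eb (fun b => (\sum_k z k e * bern_std q (b k)) ^+ 2) = had_var h U C e.
    have m0 k : bern_law q true * (z k e * bern_std q true) +
        bern_law q false * (z k e * bern_std q false) = 0.
      by rewrite !(mulrCA _ (z k e)) -mulrDr bern_std_mean// mulr0.
    have := @bexp_sqr_sum _ _ _ lawb (fun k b => z k e * bern_std q b) _ id.
    rewrite /Eb => /(_ (@inj_id _) m0) ->.
    rewrite -sum_sqr_z; apply: eq_bigr => k _.
    rewrite -[RHS]mulr1 -(bern_std_var q0 q1).
    by move: (z k e) (bern_std q true) (bern_std q false) => *; ring.
  by have := sqr_ge0 (had_var h U C e - goe_var C - 1); nra.
rewrite /Ee bexpD bexp_cst// lerD2l.
exact: (had_var_conc C hW U_orth eta_le n0).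
Qed.

End conditional_clt.

(** * Functions of discrete random variables *)

Section discrete_laws.
Local Open Scope ereal_scope.
Context d (T : measurableType d) (R : realType) (P : probability T R).

(** The atoms, on which every variable has a prescribed value, are disjoint and
    carry the total mass, so [f] is almost surely a step function. *)
Lemma expectation_discrete (K A : finType) (X : K -> {RV P >-> R})
    (x wt : A -> K -> R) (f : T -> R) (F : A -> R) :
  mutually_independent X ->
  (forall a a', x a =1 x a' -> a = a') ->
  (forall a k, P (X k @^-1` [set x a k]) = (wt a k)%:E) ->
  (\sum_a \prod_k wt a k = 1)%R ->
  measurable_fun setT f ->
  (forall t a, (forall k, X k t = x a k) -> f t = F a) ->
  \int[P]_t (f t)%:E = (\sum_a (\prod_k wt a k) * F a)%:E.
Proof.
move=> indep x_inj Px sum1 mf fF.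
pose At a := \bigcap_(k in [set: K]) (X k @^-1` [set x a k]).
have mX k a : measurable (X k @^-1` [set x a k]).
  by rewrite -[X in measurable X]setTI; apply: measurable_funP => //; exact: measurable_set1.
have mAt a : measurable (At a).
  by apply: fin_bigcap_measurable => [|k _]; [exact: finite_finset|exact: mX].
have PAt a : P (At a) = (\prod_k wt a k)%:E.
  rewrite /At indep; last by move=> k; exact: measurable_set1.
  by rewrite -prodEFin; apply: eq_bigr => k _; rewrite Px.
pose g t : R := (\sum_a F a * \1_(At a) t)%R.
have mg : measurable_fun setT g.
  by apply: measurable_sum => a; apply: measurable_realfun.measurable_funM.
have At_disj a a' t : At a t -> At a' t -> a = a'.
  move=> h h'; apply: x_inj => k; rewrite -[LHS](h k I).
  exact: (h' k I).
have gF a t : At a t -> g t = F a.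
  move=> h; rewrite /g (bigD1 a)//= indicE mem_set// mulr1 big1 ?addr0// => a' aa'.
  rewrite indicE memNset ?mulr0// => h'.
  by move: aa'; rewrite (At_disj _ _ _ h h') eqxx.
pose D := \bigcup_(a in [set: A]) At a.
have mD : measurable D.
  by apply: fin_bigcup_measurable => [|a _]; [exact: finite_finset|exact: mAt].
have PD : P D = 1.
  rewrite /D measure_fin_bigcup; last 3 first.
  - exact: finite_finset.
  - by move=> a a' _ _ [t [h h']]; exact: (At_disj _ _ _ h h').
  - by move=> a _; exact: mAt.
  have -> : [set: A] = [set` index_enum A].
    by apply/seteqP; split=> a //= _; exact: mem_index_enum.
  rewrite -fsbig_seq ?index_enum_uniq//.
  rewrite (eq_bigr (fun a => (\prod_k wt a k)%:E)); last by move=> a _; exact: PAt.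
  by rewrite sumEFin sum1.
have fg : ae_eq P setT (EFin \o f) (EFin \o g).
  exists (~` D); split.
  - exact: measurableC.
  - by apply: (etrans (probability_setC P mD)); rewrite PD subee.
  - move=> t /=; apply: contra_not => -[a _ h] _ /=.
    by rewrite (gF _ _ h) (fF _ a (fun k => h k I)).
transitivity (\int[P]_t (g t)%:E).
  by apply: ae_eq_integral => //; exact/measurable_EFinP.
rewrite /g; under eq_integral do rewrite -sumEFin.
have ind a : P.-integrable setT (fun t => (\1_(At a) t)%:E) by exact: integrable_indic.
rewrite integral_sum//; last first.
  by move=> a; under eq_fun do rewrite EFinM; exact: integrableZl.
rewrite -sumEFin; apply: eq_bigr => a _.
under eq_integral do rewrite EFinM.
by rewrite integralZl// integral_indic// setIT EFinM muleC -PAt.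
Qed.
End discrete_laws.

(** * Trigonometric polynomials and Bernstein approximation *)

Section trig_polynomials.
Variables (R : realType) (k : nat).
Implicit Types (t x : 'cV[R]_k) (g : 'cV[R]_k -> R).

Definition cdot t x : R := \sum_c t c 0 * x c 0.

(** The phase [a] makes the generators cover sines too, and keeps products of
    generators within the family. *)
Inductive trigpoly : ('cV[R]_k -> R) -> Prop :=
| trigpoly_cos t (a : R) : trigpoly (fun x => cos (cdot t x + a))
| trigpoly_lin (a : R) g g' :
    trigpoly g -> trigpoly g' -> trigpoly (fun x => a * g x + g' x).

Lemma cdot0 x : cdot 0 x = 0.
Proof. by rewrite /cdot big1// => c _; rewrite mxE mul0r. Qed.

Lemma cdotD t t' x : cdot (t + t') x = cdot t x + cdot t' x.
Proof.
by rewrite /cdot -big_split; apply: eq_bigr => c _; rewrite mxE mulrDl.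
Qed.

Lemma cdotN t x : cdot (- t) x = - cdot t x.
Proof. by rewrite /cdot -sumrN; apply: eq_bigr => c _; rewrite mxE mulNr. Qed.

Lemma trigpoly0 : trigpoly (fun=> 0).
Proof.
have := trigpoly_cos 0 (pi / 2); congr trigpoly; apply/funext => x.
by rewrite cdot0 add0r cos_pihalf.
Qed.

Lemma trigpolyZ a g : trigpoly g -> trigpoly (fun x => a * g x).
Proof.
move=> hg; have := trigpoly_lin a hg trigpoly0; congr trigpoly.
by apply/funext => x; rewrite addr0.
Qed.

Lemma trigpoly_cst a : trigpoly (fun=> a).
Proof.
have := trigpolyZ a (trigpoly_cos 0 0); congr trigpoly; apply/funext => x.
by rewrite cdot0 add0r cos0 mulr1.
Qed.

Lemma trigpolyD g g' : trigpoly g -> trigpoly g' -> trigpoly (fun x => g x + g' x).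
Proof.
move=> hg hg'; have := trigpoly_lin 1 hg hg'; congr trigpoly.
by apply/funext => x; rewrite mul1r.
Qed.

Lemma trigpolyM g g' : trigpoly g -> trigpoly g' -> trigpoly (fun x => g x * g' x).
Proof.
move=> hg hg'; elim: hg => [t a|a g1 g2 _ h1 _ h2]; last first.
  have := trigpoly_lin a h1 h2; congr trigpoly.
  by apply/funext => x; ring.
elim: hg' => [t' a'|a' g1 g2 _ h1 _ h2]; last first.
  have := trigpoly_lin a' h1 h2; congr trigpoly.
  by apply/funext => x; ring.
have := trigpoly_lin (2^-1) (trigpoly_cos (t + t') (a + a'))
  (trigpolyZ (2^-1) (trigpoly_cos (t - t') (a - a'))).
congr trigpoly; apply/funext => x; rewrite !cdotD cdotN.
have -> : cdot t x + cdot t' x + (a + a') = (cdot t x + a) + (cdot t' x + a') by ring.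
have -> : cdot t x - cdot t' x + (a - a') = (cdot t x + a) - (cdot t' x + a') by ring.
by rewrite cosD cosB; field.
Qed.

Lemma trigpoly_sum (J : Type) (r : seq J) (g : J -> 'cV[R]_k -> R) :
  (forall j, trigpoly (g j)) -> trigpoly (fun x => \sum_(j <- r) g j x).
Proof.
move=> h; elim: r => [|j r IH].
  by under eq_fun do rewrite big_nil; exact: trigpoly0.
by under eq_fun do rewrite big_cons; exact: trigpolyD.
Qed.

Lemma trigpoly_prod (J : Type) (r : seq J) (g : J -> 'cV[R]_k -> R) :
  (forall j, trigpoly (g j)) -> trigpoly (fun x => \prod_(j <- r) g j x).
Proof.
move=> h; elim: r => [|j r IH].
  by under eq_fun do rewrite big_nil; exact: trigpoly_cst.
by under eq_fun do rewrite big_cons; exact: trigpolyM.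
Qed.

Lemma trigpoly_sin (a : R) c : trigpoly (fun x => sin (a * x c 0)).
Proof.
have := trigpoly_cos (a *: delta_mx c 0) (- (pi / 2)); congr trigpoly.
apply/funext => x; rewrite cosBpihalf; congr sin.
rewrite /cdot (bigD1 c)//= !mxE !eqxx mulr1 big1 ?addr0// => c' /negbTE cc'.
by rewrite !mxE cc' /= mulr0 mul0r.
Qed.

Lemma trigpoly_bounded g : trigpoly g -> exists B, forall x, `|g x| <= B.
Proof.
elim=> [t a|a g1 g2 _ [B1 h1] _ [B2 h2]].
  by exists 1 => x; exact: cos_max.
exists (`|a| * B1 + B2) => x; rewrite (le_trans (ler_normD _ _))// lerD//.
by rewrite normrM ler_wpM2l.
Qed.

End trig_polynomials.

Section box.
Variables (R : realType) (k : nat).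

Definition in_box (L : R) (x : 'cV[R]_k) : Prop := forall c, `|x c 0| <= L.

Lemma continuous_coords (f : 'cV[R]_k -> R) (x : 'cV[R]_k) (eps : R) :
  continuous f -> 0 < eps ->
  exists2 r, 0 < r & forall y : 'cV[R]_k,
    (forall c, `|x c 0 - y c 0| < r) -> `|f x - f y| < eps.
Proof.
move=> cf e0; have /cvgrPdist_lt/(_ _ e0)/nbhs_ballP[r /= r0 hr] := cf x.
exists r => // y xy; apply: hr; split=> // i j.
by rewrite !ord1; exact: xy.
Qed.

(** Compactness of the box; the second point is free, so that the Bernstein
    nodes need not be located. *)
Lemma box_unif_continuous (f : 'cV[R]_k -> R) (L eps : R) :
  continuous f -> 0 < eps ->
  exists2 del, 0 < del & forall x y : 'cV[R]_k, in_box L x ->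
    (forall c, `|x c 0 - y c 0| <= del) -> `|f x - f y| <= eps.
Proof.
move=> cf e0; pose K := [set v : 'rV[R]_k | forall i, v ord0 i \in `[- L, L]].
have cK : compact K.
  apply: (@rV_compact _ k (fun=> `[- L, L]%classic)) => _.
  exact: segment_compact.
pose Q (del : R) (v : 'rV[R]_k) := forall y : 'cV[R]_k,
  (forall c, `|v 0 c - y c 0| <= del) -> `|f v^T - f y| <= eps.
have : \forall del \near 0^'+, K `<=` Q del.
  move: cK => /compact_near_coveringP; apply => v Kv.
  have e20 : 0 < eps / 2 by rewrite divr_gt0.
  have [r r0 hr] := continuous_coords v^T cf e20.
  have r20 : 0 < r / 2 by rewrite divr_gt0.
  exists (ball v (r / 2), [set del | del < r / 2]) => /=.
    by split; [exact: nbhsx_ballx|exact: nbhs_right_lt].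
  move=> [v' del] /= [[_ vv'] dr] y v'y.
  have h1 : `|f v^T - f v'^T| < eps / 2.
    apply: hr => c; rewrite !mxE; apply: lt_le_trans (vv' 0 c) _.
    by rewrite ler_pdivrMr// ler_peMr ?ler1n// ltW.
  have h2 : `|f v^T - f y| < eps / 2.
    apply: hr => c; rewrite !mxE; have := vv' 0 c; rewrite /ball /= => h.
    have := v'y c => h'; rewrite (le_lt_trans (ler_distD (v' 0 c) _ _))//; lra.
  rewrite (le_trans (ler_distD (f v^T) _ _))// distrC; lra.
move=> hQ; have [del [d0 hd]] := filter_ex (filterI (nbhs_right_gt (0 : R)) hQ).
exists del => // x y Lx xy; have := hd x^T; rewrite /Q trmxK; apply.
  by move=> i; rewrite /= mxE in_itv /= -ler_norml.
by move=> c; rewrite mxE.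
Qed.

End box.

Section bernstein.
Variables (R : realType) (k N : nat).
Hypothesis N0 : (0 < N)%N.

Definition bool_sign (b : bool) : R := if b then 1 else -1.

(** For each coordinate and each trial, a biased sign of mean [sin (a * x c)].
    Its law is affine in a sine, which makes Bernstein means trigonometric
    polynomials in [x]. *)
Definition sin_law (a : R) (x : 'cV[R]_k) (ci : 'I_k * 'I_N) (b : bool) : R :=
  (1 + bool_sign b * sin (a * x ci.1 0)) / 2.

Definition trial_mean (b : {ffun 'I_k * 'I_N -> bool}) (c : 'I_k) : R :=
  (\sum_(i < N) bool_sign (b (c, i))) / N%:R.

Lemma sin_law_bit a x : bit_law (sin_law a x).
Proof.
split=> [ci b|ci]; last by rewrite /sin_law /bool_sign; field.
rewrite /sin_law divr_ge0//; have := sin_le1 (a * x ci.1 0).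
by have := sin_geN1 (a * x ci.1 0); rewrite /bool_sign; case: b; lra.
Qed.

Lemma trial_mean_var a x c :
  bexp (sin_law a x) (fun b => (trial_mean b c - sin (a * x c 0)) ^+ 2) <= N%:R^-1.
Proof.
set s := sin _; have Nr0 : N%:R != 0 :> R by rewrite pnatr_eq0 -lt0n.
pose g (ci : 'I_k * 'I_N) b : R := (bool_sign b - sin (a * x ci.1 0)) / N%:R.
have -> : bexp (sin_law a x) (fun b => (trial_mean b c - s) ^+ 2) =
    bexp (sin_law a x) (fun b => (\sum_(i < N) g (c, i) (b (c, i))) ^+ 2).
  apply: eq_bexp => b; congr (_ ^+ _); rewrite /g -mulr_suml /trial_mean sumrB /=.
  by rewrite sumr_const card_ord -/s -[s *+ N]mulr_natr mulrBl mulfK.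
have inj_c : injective (fun i : 'I_N => (c, i)) by move=> i j [].
rewrite (@bexp_sqr_sum _ _ _ (sin_law_bit a x) g _ (fun i => (c, i)) inj_c).
  rewrite (eq_bigr (fun=> (1 - s ^+ 2) / N%:R ^+ 2)) => [|i _]; last first.
    by rewrite /g /sin_law /= -/s /bool_sign; field.
  rewrite sumr_const card_ord -[leLHS]mulr_natr.
  have -> : (1 - s ^+ 2) / N%:R ^+ 2 * N%:R = (1 - s ^+ 2) * N%:R^-1 by field.
  by rewrite ler_piMl ?invr_ge0 ?ler0n// gerBl sqr_ge0.
by move=> ci; rewrite /g /sin_law /bool_sign; field.
Qed.

Lemma trigpoly_bernstein a (F : {ffun 'I_k * 'I_N -> bool} -> R) :
  trigpoly (fun x => bexp (sin_law a x) F).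
Proof.
apply: trigpoly_sum => b; have hp : trigpoly (fun x =>
    F b * \prod_ci sin_law a x ci (b ci)).
  apply: trigpolyZ; apply: trigpoly_prod => ci.
  have := trigpolyD (trigpoly_cst k 2^-1)
    (trigpolyZ (bool_sign (b ci) / 2) (trigpoly_sin a ci.1)).
  by congr trigpoly; apply/funext => x; rewrite /sin_law; field.
by move: hp; congr trigpoly; apply/funext => x; rewrite mulrC.
Qed.

End bernstein.

Section approximation.
Variable R : realType.

Lemma sin_expand (x y : R) : - 2^-1 <= x -> x <= y -> y <= 2^-1 ->
  y - x <= 2 * (sin y - sin x).
Proof.
move=> xl xy yu; have [c /andP[xc cy] ->] := sin_MVT xy.
have : `|c| <= 2^-1 by rewrite ler_norml; apply/andP; split; lra.
rewrite -(@ler_pXn2r _ 2)// ?nnegrE ?invr_ge0// real_normK ?num_real//.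
rewrite (_ : 2^-1 ^+ 2 = 4^-1 :> R); last by field.
move=> c2; have := cos_ge1B c => cc.
have yx : 0 <= y - x by rewrite subr_ge0.
have : 2^-1 * (y - x) <= cos c * (y - x) by rewrite ler_wpM2r//; lra.
lra.
Qed.

(** The witness is the arc sine of [v] truncated to the interval of radius one
    half, on which the derivative of the sine is at least one half. *)
Lemma sin_half_inv (v : R) : exists y : R, forall x : R, `|x| <= 2^-1 ->
  `|x - y| <= 2 * `|sin x - v|.
Proof.
have h0 : - 2^-1 <= (2^-1 : R) by lra.
have [v1|v1] := leP (sin (2^-1)) v.
  exists 2^-1 => x; rewrite ler_norml => /andP[xl xu].
  have h := sin_expand xl xu (lexx _).
  rewrite distrC ger0_norm ?subr_ge0// (le_trans h)// ler_wpM2l//.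
  by rewrite distrC (le_trans _ (ler_norm _))// lerD2r.
have [v2|v2] := leP v (sin (- 2^-1)).
  exists (- 2^-1) => x; rewrite ler_norml => /andP[xl xu].
  have h := sin_expand (lexx _) xl xu.
  rewrite ger0_norm ?subr_ge0// (le_trans h)// ler_wpM2l//.
  by rewrite (le_trans _ (ler_norm _))// lerD2l lerN2.
have csin : {within `[- 2^-1, 2^-1], continuous (@sin R)}.
  by apply: continuous_subspaceT => z; apply: continuous_sin.
have [|y] := IVT h0 csin (v := v).
  by rewrite ge_min le_max (ltW v1) (ltW v2) !orbT.
rewrite in_itv /= => /andP[yl yu] yv; exists y => x; rewrite ler_norml => /andP[xl xu].
rewrite -yv; have [xy|/ltW yx] := leP x y.
  have h := sin_expand xl xy yu.
  rewrite distrC ger0_norm ?subr_ge0// (le_trans h)// ler_wpM2l//.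
  by rewrite distrC ler_norm.
have h := sin_expand yl yx xu.
by rewrite ger0_norm ?subr_ge0// (le_trans h)// ler_wpM2l// ler_norm.
Qed.

(** Bernstein approximation in the variables [sin (x c / (2 * L))], which
    determine the point in the box. The approximant is a trigonometric
    polynomial, and as a mean of values of [f] it inherits the bound of [f]
    everywhere; by the law of large numbers it is close to [f] on the box. *)
Lemma trigpoly_approx k (f : 'cV[R]_k -> R) (M L eps : R) :
  continuous f -> (forall x, `|f x| <= M) -> 0 < L -> 0 < eps ->
  exists g, [/\ trigpoly g, forall x, `|g x| <= M &
    forall x, in_box L x -> `|f x - g x| <= eps].
Proof.
move=> cf fM L0 eps0; have M0 : 0 <= M := le_trans (normr_ge0 _) (fM 0).
have e20 : 0 < eps / 2 by rewrite divr_gt0.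
have [del del0 hdel] := box_unif_continuous L cf e20.
(* A coordinate that is off by more than [del] comes from a trial mean whose
   squared error is more than [lip^-1]. *)
pose lip : R := (4 * L / del) ^+ 2.
have lip0 : 0 <= lip by rewrite sqr_ge0.
pose N := (Num.truncn (2 * M * k%:R * lip / (eps / 2))).+1.
have N0 : (0 < N)%N by [].
have Nr0 : 0 < N%:R :> R by rewrite ltr0n.
have N_big : 2 * M * (lip * (k%:R * N%:R^-1)) <= eps / 2.
  have -> : 2 * M * (lip * (k%:R * N%:R^-1)) = (2 * M * k%:R * lip) / N%:R by ring.
  by rewrite ler_pdivrMr// [leRHS]mulrC -ler_pdivrMr// ltW// /N truncnS_gt.
pose a : R := (2 * L)^-1.
pose inv (v : R) := sval (cid (sin_half_inv v)).
have invP v : forall x : R, `|x| <= 2^-1 -> `|x - inv v| <= 2 * `|sin x - v|.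
  by rewrite /inv; case: cid.
pose node (b : {ffun 'I_k * 'I_N -> bool}) : 'cV[R]_k :=
  \col_c (2 * L * inv (trial_mean R b c)).
have law (x : 'cV[R]_k) := sin_law_bit N a x.
exists (fun x => bexp (sin_law a x) (fun b => f (node b))); split.
- exact: trigpoly_bernstein.
- move=> x; rewrite (le_trans (bexp_norm (law x) _))//.
  by rewrite -[leRHS](bexp_cst (law x)); apply: (le_bexp (law x)) => b.
move=> x Lx; rewrite -[f x](bexp_cst (law x)) (le_trans (bexp_dist (law x) _ _))//.
pose q c (b : {ffun 'I_k * 'I_N -> bool}) := (trial_mean R b c - sin (a * x c 0)) ^+ 2.
apply: (@le_trans _ _ (bexp (sin_law a x) (fun b =>
   eps / 2 + 2 * M * (lip * \sum_c q c b)))).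
  apply: (le_bexp (law x)) => b.
  have S0 : 0 <= \sum_c q c b by apply: sumr_ge0 => c _; exact: sqr_ge0.
  have hc c : `|x c 0 - node b c 0| <= 4 * L * `|trial_mean R b c - sin (a * x c 0)|.
    rewrite mxE; have -> : x c 0 - 2 * L * inv (trial_mean R b c) =
      2 * L * (a * x c 0 - inv (trial_mean R b c)).
      by rewrite /a; field; rewrite gt_eqF.
    rewrite normrM (@ger0_norm _ (2 * L)) ?mulr_ge0 ?(ltW L0)//.
    have ax : `|a * x c 0| <= 2^-1.
      have a0 : 0 <= a by rewrite invr_ge0 mulr_ge0// ltW.
      have aL : a * L = 2^-1 by rewrite /a; field; rewrite gt_eqF.
      by rewrite normrM (ger0_norm a0) -aL ler_wpM2l.
    have h := invP (trial_mean R b c) _ ax.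
    rewrite (distrC (trial_mean R b c)).
    have L20 : 0 <= 2 * L by rewrite mulr_ge0// ltW.
    rewrite (le_trans (ler_wpM2l L20 h))// le_eqVlt; apply/orP; left.
    by apply/eqP; ring.
  have [small|] := pselect (forall c, `|x c 0 - node b c 0| <= del).
    rewrite (le_trans (hdel x _ Lx small))// lerDl.
    by apply: mulr_ge0; apply: mulr_ge0.
  move=> /existsNP[c /negP]; rewrite -ltNge => big_c.
  have big_q : 1 <= lip * q c b.
    rewrite /lip /q -[X in _ * X]real_normK ?num_real// -exprMn.
    have u1 : 1 <= 4 * L / del * `|trial_mean R b c - sin (a * x c 0)|.
      by rewrite mulrAC ler_pdivlMr// mul1r (le_trans (ltW big_c)).
    exact: exprn_ege1.
  rewrite (@le_trans _ _ (2 * M))//.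
    rewrite (le_trans (ler_normB _ _))//; have := fM x; have := fM (node b); lra.
  rewrite ler_wpDl ?(ltW e20)// ler_peMr ?mulr_ge0//.
  rewrite (le_trans big_q)// ler_wpM2l// (bigD1 c)//= lerDl sumr_ge0// => c' _.
  exact: sqr_ge0.
rewrite bexpD (bexp_cst (law x)) bexpZ bexpZ bexp_sum.
rewrite [leRHS](_ : eps = eps / 2 + eps / 2); last by field.
rewrite lerD2l (le_trans _ N_big)// ler_wpM2l ?mulr_ge0// ler_wpM2l//.
rewrite mulr_natl -[k in leRHS]card_ord -sumr_const; apply: ler_sum => c _.
exact: trial_mean_var.
Qed.

End approximation.

(** * The continuity theorem *)

Section bounded_expectation.
Context d (T : measurableType d) (R : realType) (P : probability T R).

Lemma bounded_integrable (f : T -> R) (M : R) :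
  measurable_fun setT f -> (forall w, `|f w| <= M) ->
  P.-integrable setT (EFin \o f).
Proof.
move=> mf fM; have := finite_measure_integrable_cst P M measurableT.
apply: le_integrable => //; first exact/measurable_EFinP.
by move=> w _ /=; rewrite lee_fin (le_trans (fM w))// ler_norm.
Qed.

Lemma bounded_expectation (f : T -> R) (M : R) :
  measurable_fun setT f -> (forall w, `|f w| <= M) ->
  ('E_P[f] = (\int[P]_w f w)%:E)%E.
Proof.
move=> mf fM; rewrite unlock /Rintegral fineK//.
exact: (integrable_fin_num measurableT (bounded_integrable mf fM)).
Qed.

Lemma Rintegral_cst_prob (a : R) : \int[P]_w a = a.
Proof.
rewrite Rintegral_cst//; have /(congr1 fine) := probability_setT P.
by rewrite -[LHS]/(fine _) /= => e; apply: etrans (mulr1 a); congr (_ * _).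
Qed.

End bounded_expectation.

Section random_vectors.
Context d (T : measurableType d) (R : realType) (k : nat) (X : T -> 'cV[R]_k).
Hypothesis mX : forall c, measurable_fun setT (fun w => X w c 0).

Lemma measurable_trigpoly g : trigpoly g -> measurable_fun setT (g \o X).
Proof.
elim=> [t a|a g1 g2 _ h1 _ h2] /=.
  apply: (measurableT_comp (continuous_measurable_fun (@continuous_cos R))).
  apply: measurable_funD => //; apply: measurable_sum => c.
  exact: measurable_funM.
by apply: measurable_funD => //; exact: measurable_funM.
Qed.

Lemma measurable_box (L : R) : measurable [set w | in_box L (X w)].
Proof.
rewrite (_ : [set w | _] = \bigcap_(c in [set: 'I_k]) [set w | `|X w c 0| <= L]).
  apply: fin_bigcap_measurable => // c _.
  rewrite -[X in measurable X]setTI.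
  apply: (@measurable_fun_le _ _ _ setT (fun w => `|X w c 0|) (cst L)) => //.
  exact: measurableT_comp.
by apply/seteqP; split=> w /= h c; [move=> _|]; exact: h.
Qed.

(** A bounded continuous function is the pointwise limit of trigonometric
    polynomials close to it on growing boxes. *)
Lemma measurable_continuous_vec (f : 'cV[R]_k -> R) (M : R) :
  continuous f -> (forall x, `|f x| <= M) -> measurable_fun setT (f \o X).
Proof.
move=> cf fM.
have approx (n : nat) : exists g, trigpoly g /\
    forall x, in_box n.+1%:R x -> `|f x - g x| <= n.+1%:R^-1.
  have n0 : 0 < n.+1%:R :> R by rewrite ltr0n.
  have n1 : 0 < n.+1%:R^-1 :> R by rewrite invr_gt0.
  by have [g [h1 _ h3]] := trigpoly_approx cf fM n0 n1; exists g.
pose g n := sval (cid (approx n)).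
have gT n : trigpoly (g n) by rewrite /g; case: cid => ? [].
have gf n x : in_box n.+1%:R x -> `|f x - g n x| <= n.+1%:R^-1.
  by rewrite /g; case: cid => g0 [_ h] /=; exact: h.
apply: (measurable_fun_cvg (h := fun n => g n \o X)) => [n|w _].
  exact: measurable_trigpoly.
apply/cvgrPdist_le => e e0; near=> n.
have nb : in_box n.+1%:R (X w).
  move=> c; have : `|X w c 0| <= \sum_c `|X w c 0|.
    by rewrite (bigD1 c)//= lerDl sumr_ge0.
  move/le_trans; apply; apply: (@le_trans _ _ n%:R); last by rewrite ler_nat.
  by near: n; exact: nbhs_infty_ger.
rewrite (le_trans (gf n _ nb))//; near: n.
have := near_infty_natSinv_lt (PosNum e0); apply: filterS => n h.
exact: ltW h.
Unshelve. all: by end_near. Qed.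

End random_vectors.

Section continuity_theorem.
Variables (R : realType) (k : nat).

Section one_vector.
Context d (T : measurableType d) (P : probability T R) (X : T -> 'cV[R]_k).
Hypothesis mX : forall c, measurable_fun setT (fun w => X w c 0).

(** Off the box the two functions differ by at most [2 * M]. *)
Lemma expectation_approx (f g : 'cV[R]_k -> R) (M L eps : R) :
  continuous f -> trigpoly g -> (forall x, `|f x| <= M) -> (forall x, `|g x| <= M) ->
  (forall x, in_box L x -> `|f x - g x| <= eps) -> 0 <= eps ->
  `|\int[P]_w f (X w) - \int[P]_w g (X w)| <=
  eps + 2 * M * fine (P (~` [set w | in_box L (X w)])).
Proof.
move=> cf tg fM gM fg e0; set B := [set w | in_box L (X w)].
have mB : measurable B := measurable_box mX L.
have mf := measurable_continuous_vec mX cf fM.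
have mg := measurable_trigpoly mX tg.
have intf : P.-integrable setT (EFin \o (f \o X)) by apply: (bounded_integrable P mf) => w; exact: fM.
have intg : P.-integrable setT (EFin \o (g \o X)) by apply: (bounded_integrable P mg) => w; exact: gM.
have M0 : 0 <= M := le_trans (normr_ge0 _) (fM 0).
rewrite -RintegralB//.
have mfg : measurable_fun setT (fun w => f (X w) - g (X w)) by exact: measurable_funB.
have fgM w : `|f (X w) - g (X w)| <= 2 * M.
  by rewrite (le_trans (ler_normB _ _))//; have := fM (X w); have := gM (X w); lra.
have intfg := bounded_integrable P mfg fgM.
rewrite (le_trans (le_normr_Rintegral _ _))//.
pose u w : R := eps + 2 * M * \1_(~` B) w.
have mB' : measurable (~` B) by exact: measurableC.
have int1 : P.-integrable setT (EFin \o \1_(~` B)) by exact: integrable_indic.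
have int1' : P.-integrable setT (EFin \o (fun w => 2 * M * \1_(~` B) w)).
  by under [EFin \o _]eq_fun do rewrite /= EFinM; exact: integrableZl.
have inte : P.-integrable setT (EFin \o cst eps) by exact: finite_measure_integrable_cst.
rewrite (@le_trans _ _ (\int[P]_w u w))//.
  apply: le_Rintegral => //.
  - apply: (bounded_integrable P (M := 2 * M)); first exact: measurableT_comp.
    by move=> w; rewrite normr_id.
  - by rewrite /u; under [EFin \o _]eq_fun do rewrite /= EFinD; exact: integrableD.
  - move=> w _; rewrite /u indicE; have [wB|wB] := boolP (w \in ~` B).
      by rewrite mulr1 (le_trans (fgM w))// lerDr.
    rewrite mulr0 addr0; apply: fg; move: wB; rewrite notin_setE => /contrapT.
    by [].
rewrite RintegralD// (Rintegral_cst_prob P) lerD2l RintegralZl// ler_wpM2l ?mulr_ge0//.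
by rewrite /Rintegral integral_indic// setIT.
Qed.

End one_vector.

Context (d : nat -> measure_display) (T : forall n, measurableType (d n)).
Context (P : forall n, probability (T n) R) (X : forall n, T n -> 'cV[R]_k).
Context (d' : measure_display) (T' : measurableType d') (P' : probability T' R).
Context (Z : T' -> 'cV[R]_k).
Arguments X : clear implicits.
Hypothesis mX : forall n c, measurable_fun setT (fun w => X n w c 0).
Hypothesis mZ : forall c, measurable_fun setT (fun w => Z w c 0).

Arguments mX : clear implicits.

Hypothesis tight : forall eps : R, 0 < eps -> exists2 L : R, 0 < L &
  (P' (~` [set w | in_box L (Z w)]) <= eps%:E)%E /\
  \forall n \near \oo, (P n (~` [set w | in_box L (X n w)]) <= eps%:E)%E.

Hypothesis char_cvg : forall t (a : R),
  \int[P n]_w cos (cdot t (X n w) + a) @[n --> \oo] -->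
  \int[P']_w cos (cdot t (Z w) + a).

Lemma trigpoly_cvg g : trigpoly g ->
  \int[P n]_w g (X n w) @[n --> \oo] --> \int[P']_w g (Z w).
Proof.
have int_tp d0 (T0 : measurableType d0) (P0 : probability T0 R) (Y : T0 -> 'cV[R]_k) g0 :
    (forall c, measurable_fun setT (fun w => Y w c 0)) -> trigpoly g0 ->
    P0.-integrable setT (EFin \o (g0 \o Y)).
  move=> mY tg0; have [B hB] := trigpoly_bounded tg0.
  apply: (bounded_integrable P0 (measurable_trigpoly mY tg0)) => w.
  exact: hB.
elim=> [t a|a g1 g2 t1 h1 t2 h2]; first exact: char_cvg.
have lin d0 (T0 : measurableType d0) (P0 : probability T0 R) (Y : T0 -> 'cV[R]_k) :
    (forall c, measurable_fun setT (fun w => Y w c 0)) ->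
    \int[P0]_w (a * g1 (Y w) + g2 (Y w)) =
    a * \int[P0]_w g1 (Y w) + \int[P0]_w g2 (Y w).
  move=> mY; have i1 := int_tp _ _ P0 _ _ mY t1; have i2 := int_tp _ _ P0 _ _ mY t2.
  rewrite RintegralD ?RintegralZl//.
  by under [EFin \o _]eq_fun do rewrite /= EFinM; exact: integrableZl.
rewrite lin//; under eq_fun do rewrite lin//.
by apply: cvgD => //; apply: cvgM => //; exact: cvg_cst.
Qed.

(** On a large box a bounded continuous function is close to a trigonometric
    polynomial with the same bound, whose means converge; tightness controls
    the complement of the box. *)
Lemma levy_continuity : cvg_in_law P X P' Z.
Proof.
move=> f cf [M fM]; have M0 : 0 <= M := le_trans (normr_ge0 _) (fM 0).
have mfX n := measurable_continuous_vec (mX n) cf fM.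
have mfZ := measurable_continuous_vec mZ cf fM.
have eX n : ('E_(P n)[f \o X n] = (\int[P n]_w f (X n w))%:E)%E.
  by apply: (bounded_expectation (P n) (mfX n) (M := M)) => w; exact: fM.
have eZ : ('E_P'[f \o Z] = (\int[P']_w f (Z w))%:E)%E.
  by apply: (bounded_expectation P' mfZ (M := M)) => w; exact: fM.
rewrite eZ; under eq_fun do rewrite eX; apply: cvg_EFin; first exact: nearW.
apply/cvgrPdist_le => e e0.
have M1 : 0 < 2 * M + 1 by rewrite ltr_wpDl// mulr_ge0.
pose del := e / 5; have del0 : 0 < del by rewrite divr_gt0.
have eps0 : 0 < del / (2 * M + 1) by rewrite divr_gt0.
have [L L0 [tZ tX]] := tight eps0.
have [g [tg gM fg]] := trigpoly_approx cf fM L0 del0.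
have tail d0 (T0 : measurableType d0) (P0 : probability T0 R) (Y : T0 -> 'cV[R]_k) :
    (forall c, measurable_fun setT (fun w => Y w c 0)) ->
    (P0 (~` [set w | in_box L (Y w)]) <= (del / (2 * M + 1))%:E)%E ->
    `|\int[P0]_w f (Y w) - \int[P0]_w g (Y w)| <= 2 * del.
  move=> mY tY; rewrite (le_trans (expectation_approx P0 mY cf tg fM gM fg (ltW del0)))//.
  have mB := measurableC (measurable_box mY L).
  set q := P0 _ in tY *; have q0 : (0 <= q)%E by exact: measure_ge0.
  have : fine q <= del / (2 * M + 1).
    move: tY q0; case: q => [r| |]//=; by rewrite lee_fin.
  move=> hq; rewrite (_ : 2 * del = del + del); last by ring.
  rewrite lerD2l (@le_trans _ _ ((2 * M + 1) * (del / (2 * M + 1))))//.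
    by rewrite ler_pM ?mulr_ge0 ?fine_ge0// lerDl.
  by rewrite mulrC divfK// gt_eqF.
have /cvgrPdist_le/(_ _ del0) hg := trigpoly_cvg tg.
near=> n.
have hX : `|\int[P n]_w f (X n w) - \int[P n]_w g (X n w)| <= 2 * del.
  by apply: tail => //; near: n.
have hZ := tail _ _ P' Z mZ tZ.
have hXZ : `|\int[P']_w g (Z w) - \int[P n]_w g (X n w)| <= del by near: n.
move: hX hZ hXZ; rewrite /= /del.
set a := \int[P n]_w f _; set b := \int[P n]_w g _.
set a' := \int[P']_w f _; set b' := \int[P']_w g _.
rewrite !ler_norml => /andP[? ?] /andP[? ?] /andP[? ?].
by apply/andP; split; lra.
Unshelve. all: by end_near. Qed.

End continuity_theorem.

(** * The Gaussian characteristic function *)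

Section gaussian_density.
Variable R : realType.
Notation mu := (@lebesgue_measure R).

Definition gdens (x : R) : R := normal_peak 1 * expR (- (x ^+ 2 / 2)).

Lemma gdensE : normal_pdf 0 1 = gdens.
Proof.
rewrite normal_pdfE ?oner_neq0//; apply/funext => x; rewrite /gdens /normal_fun.
by rewrite subr0 expr1n mulNr.
Qed.

Lemma gdens_ge0 x : 0 <= gdens x.
Proof. by rewrite mulr_ge0 ?normal_peak_ge0 ?expR_ge0. Qed.

Global Instance is_derive_gdens (x : R) : is_derive x 1 gdens (- x * gdens x).
Proof.
rewrite /gdens; apply: is_derive_eq.
by rewrite /GRing.scale /= ; field.
Qed.

Lemma integrable_gdens : mu.-integrable setT (EFin \o gdens).
Proof. by have := integrable_normal_pdf (0 : R) 1; rewrite gdensE. Qed.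

Lemma measurable_gdens : measurable_fun setT gdens.
Proof. by rewrite -gdensE; exact: measurable_normal_pdf. Qed.

Lemma Rintegral_gdens : \int[mu]_x gdens x = 1.
Proof. by rewrite /Rintegral -gdensE integral_normal_pdf. Qed.

Lemma norm_expR_le (x : R) : `|x| * expR (- (x ^+ 2 / 2)) <= expR (- (x ^+ 2 / 4)).
Proof.
have -> : - (x ^+ 2 / 2) = - (x ^+ 2 / 4) - x ^+ 2 / 4 by field.
rewrite expRD mulrCA ler_piMr ?expR_ge0// expRN ler_pdivrMr ?expR_gt0// mul1r.
rewrite (le_trans _ (expR_ge1Dx _))//.
have := sqr_ge0 (`|x| / 2 - 1); rewrite sqrrB expr_div_n real_normK ?num_real//.
by rewrite (_ : 2 ^+ 2 = 4 :> R); [lra|ring].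
Qed.

Lemma norm_gdens_le1 x : `|x| * gdens x <= normal_peak 1.
Proof.
rewrite /gdens mulrCA ler_piMr ?normal_peak_ge0// (le_trans (norm_expR_le x))//.
by rewrite expR_le1 oppr_le0 divr_ge0// sqr_ge0.
Qed.

(** Domination by a multiple of the normal density of variance two. *)
Lemma integrable_norm_gdens : mu.-integrable setT (EFin \o (fun x => `|x| * gdens x)).
Proof.
have s0 : Num.sqrt 2 != 0 :> R by rewrite sqrtr_eq0 -ltNge.
have p0 : 0 < normal_peak (Num.sqrt 2 : R) by rewrite normal_peak_gt0.
have := integrable_normal_pdf (0 : R) (Num.sqrt 2).
move=> /(integrableZl measurableT (normal_peak 1 / normal_peak (Num.sqrt 2))).
apply: le_integrable => //.
  apply/measurable_EFinP; apply: measurable_funM; last exact: measurable_gdens.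
  exact: normr_measurable.
move=> x _ /=; rewrite lee_fin normal_pdfE// /normal_fun subr0 sqr_sqrtr//.
have -> : - x ^+ 2 / (2 *+ 2) = - (x ^+ 2 / 4) by rewrite -mulr_natr; field.
rewrite [X in _ <= `|X|](_ : _ = normal_peak 1 * expR (- (x ^+ 2 / 4))); last first.
  by field; rewrite gt_eqF.
have h1 : 0 <= `|x| * gdens x by rewrite mulr_ge0 ?gdens_ge0.
have h2 : 0 <= normal_peak 1 * expR (- (x ^+ 2 / 4)) by rewrite mulr_ge0 ?normal_peak_ge0 ?expR_ge0.
rewrite (ger0_norm h1) (ger0_norm h2).
by rewrite /gdens mulrCA ler_wpM2l ?normal_peak_ge0// norm_expR_le.
Qed.

Variable a : R.

Let wave t (x : R) : R := cos (t * x + a) * gdens x.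

Lemma integrable_wave t : mu.-integrable setT (EFin \o wave t).
Proof.
apply: le_integrable integrable_gdens => //.
  apply/measurable_EFinP; apply: measurable_funM; last exact: measurable_gdens.
  apply: (measurableT_comp (continuous_measurable_fun (@continuous_cos R))).
  by apply: measurable_funD => //; exact: measurable_funM.
by move=> x _ /=; rewrite lee_fin /wave normrM ler_piMl// cos_max.
Qed.

(* The derivative of [wave] in [t]. *)
Let dwave t (x : R) : R := - x * sin (t * x + a) * gdens x.

Lemma is_derive_wave (t x : R) : is_derive t 1 (wave ^~ x) (dwave t x).
Proof.
rewrite /wave; apply: is_derive_eq.
by rewrite /dwave /GRing.scale /=; ring.
Qed.

Lemma dwave_le t x : `|dwave t x| <= `|x| * gdens x.
Proof.
rewrite /dwave normrM (ger0_norm (gdens_ge0 x)) ler_wpM2r ?gdens_ge0// normrM normrN.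
by rewrite ler_piMr// sin_max.
Qed.

Lemma measurable_dwave t : measurable_fun setT (dwave t).
Proof.
apply: measurable_funM; last exact: measurable_gdens.
apply: measurable_funM; first exact: oppr_measurable.
apply: (measurableT_comp (continuous_measurable_fun (@continuous_sin R))).
by apply: measurable_funD => //; exact: measurable_funM.
Qed.

Lemma integrable_dwave t : mu.-integrable setT (EFin \o dwave t).
Proof.
apply: le_integrable integrable_norm_gdens => //.
  by apply/measurable_EFinP; exact: measurable_dwave.
move=> x _ /=; rewrite lee_fin (le_trans (dwave_le t x))//.
exact: ler_norm.
Qed.

Definition gchar (t : R) : R := \int[mu]_x wave t x.

Lemma is_derive_gchar (t : R) : is_derive t 1 gchar (\int[mu]_x dwave t x).
Proof.
have tI : `]t - 1, t + 1[%classic t by rewrite /= in_itv /= ltrBlDr ltrDl ltr01.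
have der x y : `]t - 1, t + 1[%classic x -> [set: R] y -> derivable (wave ^~ y) x 1.
  by move=> _ _; have [] := is_derive_wave x y.
have dE x y : partial1of2 wave x y = dwave x y.
  by rewrite partial1of2E; have [_ ->] := is_derive_wave x y.
have ub x y : `]t - 1, t + 1[%classic x -> [set: R] y ->
    `|partial1of2 wave x y| <= `|y| * gdens y.
  by move=> _ _; rewrite dE dwave_le.
have G0 (y : R) : 0 <= `|y| * gdens y by rewrite mulr_ge0// gdens_ge0.
have intw x : `]t - 1, t + 1[%classic x -> mu.-integrable setT (EFin \o wave x).
  by move=> _; exact: integrable_wave.
have d1 := derivable_under_integral measurableT tI intw der G0 integrable_norm_gdens ub.
apply: DeriveDef => //; rewrite -derive1E.
rewrite (differentiation_under_integral measurableT tI intw der G0 integrable_norm_gdens ub).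
by apply: eq_Rintegral => y _; exact: dE.
Qed.

(* Integration by parts: [prim] vanishes at infinity, so its derivative
   [dprim = t * wave + dwave] has integral zero. *)
Let prim t (x : R) : R := sin (t * x + a) * gdens x.

Let dprim t (x : R) : R := t * wave t x + dwave t x.

Lemma is_derive_prim (t x : R) : is_derive x 1 (prim t) (dprim t x).
Proof.
rewrite /prim; apply: is_derive_eq.
by rewrite /dprim /wave /dwave /GRing.scale /=; ring.
Qed.

Lemma continuous_dprim t : continuous (dprim t).
Proof.
move=> x; have -> : dprim t = (fun x => (t * cos (t * x + a) - x * sin (t * x + a)) * gdens x).
  by apply/funext => y; rewrite /dprim /wave /dwave; ring.
apply: differentiable_continuous; apply/derivable1_diffP.
by apply: ex_derive.
Qed.

Lemma integrable_dprim t : mu.-integrable setT (EFin \o dprim t).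
Proof.
rewrite /dprim; under [EFin \o _]eq_fun do rewrite /= EFinD EFinM.
apply: integrableD => //; last exact: integrable_dwave.
by apply: integrableZl => //; exact: integrable_wave.
Qed.

Lemma FTC_dprim t (n : nat) :
  \int[mu]_(x in `[- n.+1%:R, n.+1%:R]) dprim t x = prim t n.+1%:R - prim t (- n.+1%:R).
Proof.
have n0 : - n.+1%:R < n.+1%:R :> R by rewrite gtrN// ltr0n.
rewrite /Rintegral (@continuous_FTC2 _ (dprim t) (prim t))//.
- by apply: continuous_subspaceT; exact: continuous_dprim.
- have cp : continuous (prim t).
    move=> x; apply: differentiable_continuous; apply/derivable1_diffP.
    by have [] := is_derive_prim t x.
  split.
  + by move=> x _; have [] := is_derive_prim t x.
  + exact: cvg_at_right_filter (cp _).
  + exact: cvg_at_left_filter (cp _).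
- by move=> x _; rewrite derive1E; have [_ ->] := is_derive_prim t x.
Qed.

Lemma Rintegral_dprim t : \int[mu]_x dprim t x = 0.
Proof.
pose f_ (n : nat) (x : R) : R := (dprim t \_ `[- n.+1%:R, n.+1%:R]) x.
have mD (n : nat) : measurable (`[- n.+1%:R, n.+1%:R]%classic : set R) by exact: measurable_itv.
have intd := integrable_dprim t.
have mdp : measurable_fun setT (dprim t) by apply/measurable_EFinP; exact: (measurable_int mu).
have h : (\int[mu]_x (f_ n x)%:E)%E @[n --> \oo] --> (\int[mu]_x (dprim t x)%:E)%E.
  apply: (@dominated_cvg _ _ _ mu setT measurableT _ _ (fun x => `|dprim t x|%:E)).
  - move=> n; apply/measurable_EFinP; apply/(measurable_restrictT _ (mD n)).
    exact: measurable_funTS.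
  - move=> x _; apply: cvg_EFin; first exact: nearW.
    apply: cvg_near_cst; near=> n; rewrite /= /f_ patchE mem_set//= in_itv /= -ler_norml.
    rewrite (@le_trans _ _ n%:R)// ?ler_nat//; near: n; exact: nbhs_infty_ger.
  - by [].
  - exact: (integrable_abse intd).
  - move=> n x _ /=; rewrite lee_fin /f_ patchE.
    by case: ifP => _; rewrite ?normr0.
have lim0 : ((prim t n.+1%:R - prim t (- n.+1%:R))%:E : \bar R) @[n --> \oo] --> 0%:E.
  apply: cvg_EFin; first exact: nearW.
  apply/cvgr0Pnorm_le => e e0; near=> n.
  have n0 : 0 < n.+1%:R :> R by rewrite ltr0n.
  have bnd (x : R) : `|x| = n.+1%:R -> `|prim t x| <= normal_peak 1 / n.+1%:R.
    move=> xn; rewrite ler_pdivlMr// mulrC -xn (le_trans _ (norm_gdens_le1 x))//.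
    rewrite ler_wpM2l// /prim normrM (ger0_norm (gdens_ge0 x)) ler_piMl ?gdens_ge0//.
    exact: sin_max.
  have h1 := bnd n.+1%:R (ger0_norm (ltW n0)).
  have h2 := bnd (- n.+1%:R); rewrite normrN (ger0_norm (ltW n0)) in h2.
  have {}h2 := h2 erefl.
  rewrite /= (le_trans (ler_normB _ _))// (le_trans (lerD h1 h2))//.
  rewrite -mulrDl ler_pdivrMr// mulrC -ler_pdivrMr//.
  rewrite (@le_trans _ _ n%:R)// ?ler_nat//; near: n; exact: nbhs_infty_ger.
have e (n : nat) : (\int[mu]_x (f_ n x)%:E)%E = (prim t n.+1%:R - prim t (- n.+1%:R))%:E.
  rewrite -FTC_dprim /Rintegral fineK.
    rewrite [RHS]integral_mkcond; apply: eq_integral => x _.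
    by rewrite /f_ !patchE; case: ifP.
  apply: integrable_fin_num => //; exact: (integrableS measurableT).
move: h; under eq_fun do rewrite e; move=> h.
by rewrite /Rintegral (cvg_unique _ h lim0).
Unshelve. all: by end_near. Qed.

Lemma Rintegral_dwave t : \int[mu]_x dwave t x = - t * gchar t.
Proof.
have := Rintegral_dprim t; rewrite /dprim RintegralD//; last 2 first.
- under [EFin \o _]eq_fun do rewrite /= EFinM.
  by apply: integrableZl => //; exact: integrable_wave.
- exact: integrable_dwave.
rewrite RintegralZl//; last exact: integrable_wave.
by rewrite -/(gchar t) => /eqP; rewrite addrC addr_eq0 mulNr => /eqP.
Qed.

Lemma gchar0 : gchar 0 = cos a.
Proof.
rewrite /gchar /wave; under eq_Rintegral do rewrite mul0r add0r.
by rewrite RintegralZl ?Rintegral_gdens ?mulr1//; exact: integrable_gdens.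
Qed.

(** Both sides solve [f' = - t f] with the same initial value. *)
Lemma gcharE t : gchar t = cos a * expR (- (t ^+ 2 / 2)).
Proof.
pose g (s : R) := gchar s * expR (s ^+ 2 / 2).
have dg (s : R) : is_derive s 1 g 0.
  have h := is_derive_gchar s; rewrite Rintegral_dwave in h.
  rewrite /g; apply: is_derive_eq.
  by rewrite /GRing.scale /=; field.
have -> : gchar t = g t * expR (- (t ^+ 2 / 2)).
  by rewrite /g -mulrA -expRD subrr expR0 mulr1.
congr (_ * _).
have -> : g t = g 0 by apply: is_derive_0_is_cst.
by rewrite /g gchar0 expr0n mul0r expR0 mulr1.
Qed.

End gaussian_density.

(** * Independent standard normal variables *)

Section normal_char.
Variable R : realType.
Notation mu := (@lebesgue_measure R).
Notation gauss := (@normal_prob R 0 1).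

(** By uniqueness of densities, the normal density is almost everywhere the
    Radon-Nikodym derivative of the normal law. *)
Lemma integral_normal (f : R -> R) (M : R) : measurable_fun setT f ->
  (forall x, `|f x| <= M) ->
  (\int[gauss]_x (f x)%:E = \int[mu]_x (f x * gdens x)%:E)%E.
Proof.
move=> mf fM; have dom := normal_prob_dominates (0 : R) 1.
have intf : gauss.-integrable setT (EFin \o f) := bounded_integrable gauss mf fM.
rewrite -(Radon_Nikodym_change_of_variables dom measurableT intf) /=.
pose g : R -> \bar R := Radon_Nikodym (charge_of_finite_measure gauss) mu.
have intg : mu.-integrable setT g by exact: Radon_Nikodym_integrable.
apply: ae_eq_integral => //.
- by apply: emeasurable_funM; [exact/measurable_EFinP|exact: (measurable_int mu)].
- by apply/measurable_EFinP; apply: measurable_funM => //; exact: measurable_gdens.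
have ae : ae_eq mu setT g (EFin \o gdens (R := R)).
  apply: integral_ae_eq => //; first by apply/measurable_EFinP; exact: measurable_gdens.
  move=> E _ mE; rewrite -Radon_Nikodym_integral//= /normal_prob.
  by rewrite gdensE.
apply: filterS ae => x h _ /=; rewrite EFinM.
by rewrite -/(g x) h.
Qed.

Lemma normal_cos (t a : R) :
  \int[gauss]_x cos (t * x + a) = cos a * expR (- (t ^+ 2 / 2)).
Proof.
rewrite -gcharE /gchar /Rintegral (integral_normal (M := 1))//.
  apply: (measurableT_comp (continuous_measurable_fun (@continuous_cos R))).
  by apply: measurable_funD => //; exact: measurable_funM.
by move=> x; exact: cos_max.
Qed.

End normal_char.

Section gaussian_family.
Variable R : realType.
Notation gauss := (@normal_prob R 0 1).

Definition rv_of d (T : measurableType d) (P : probability T R) (f : T -> R)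
    (mf : measurable_fun setT f) : {RV P >-> R} :=
  HB.pack_for {mfun T >-> R} f (@isMeasurableFun.Build _ _ T R f mf).

(** Each step takes the product with one more normal law; by Fubini the
    characteristic function gains one Gaussian factor. *)
Lemma gaussian_family (r : nat) :
  exists (d : measure_display) (T : measurableType d) (P : probability T R)
    (g : 'I_r -> {RV P >-> R}),
    [/\ mutually_independent g, forall i, is_std_normal (g i)
      & forall (c : 'I_r -> R) (a : R),
        \int[P]_w cos (\sum_i c i * g i w + a) =
        cos a * expR (- ((\sum_i c i ^+ 2) / 2))].
Proof.
elim: r => [|r [d [T [P [g [indep norm char]]]]]].
  exists _, _, gauss, (fun i : 'I_0 => rv_of gauss (@measurable_id _ R setT)).
  split=> [A mA|[]//|c a].
    rewrite big_ord0; rewrite (_ : \bigcap_(i in _) _ = setT).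
      exact: probability_setT.
    by apply/seteqP; split=> // x _ [].
  under eq_Rintegral do rewrite big_ord0 add0r.
  by rewrite Rintegral_cst_prob big_ord0 mul0r oppr0 expR0 mulr1.
pose P' := [the probability (T * measurableTypeR R)%type R of (P \x gauss)%E].
have mf1 j : measurable_fun setT (fun w : T * R => g j w.1).
  exact: measurableT_comp.
have mf2 : measurable_fun setT (fun w : T * R => w.2) by exact: measurable_snd.
pose g' (i : 'I_r.+1) : {RV P' >-> R} :=
  if unlift ord0 i is Some j then rv_of P' (mf1 j) else rv_of P' mf2.
have g'0 w : g' ord0 w = w.2 by rewrite /g' unlift_none.
have g'S j w : g' (lift ord0 j) w = g j w.1 by rewrite /g' liftK.
have mpre j A : measurable A -> measurable (g j @^-1` A).
  by move=> mA; rewrite -[X in measurable X]setTI; apply: measurable_funP.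
have pre0 A : g' ord0 @^-1` A = setT `*` A.
  by apply/seteqP; split=> [w|w [_]] /=; rewrite g'0.
have preS j A : g' (lift ord0 j) @^-1` A = (g j @^-1` A) `*` setT.
  by apply/seteqP; split=> [w|w [h _]] /=; [rewrite g'S|move: h; rewrite /= g'S].
have Ppre0 A : measurable A -> P' (g' ord0 @^-1` A) = gauss A.
  move=> mA; rewrite pre0 /P'; apply: (etrans (product_measure1E P gauss measurableT mA)).
  by rewrite [X in (X * _)%E]probability_setT mul1e.
have PpreS j A : measurable A -> P' (g' (lift ord0 j) @^-1` A) = P (g j @^-1` A).
  move=> mA; rewrite preS /P'.
  apply: (etrans (product_measure1E P gauss (mpre j A mA) measurableT)).
  by rewrite [X in (_ * X)%E]probability_setT mule1.
exists _, _, P', g'; split.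
- move=> A mA; rewrite big_ord_recl Ppre0//.
  rewrite (_ : \bigcap_(i in _) _ =
     (\bigcap_(j in [set: 'I_r]) (g j @^-1` A (lift ord0 j))) `*` A ord0).
    have mB : measurable (\bigcap_(j in [set: 'I_r]) (g j @^-1` A (lift ord0 j))).
      by apply: fin_bigcap_measurable => // j _; exact: mpre.
    apply: (etrans (product_measure1E P gauss mB (mA ord0))).
    rewrite muleC; congr (_ * _)%E.
    rewrite [LHS](indep (fun j => A (lift ord0 j)))//.
    by apply: eq_bigr => j _; rewrite PpreS.
  apply/seteqP; split=> [w h|w [h1 h2] i _].
    split=> /= [j _|]; first by have := h (lift ord0 j) I; rewrite /= g'S.
    by have := h ord0 I; rewrite /= g'0.
  case: (unliftP ord0 i) => [j ->|->] /=; first by rewrite g'S; exact: h1.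
  by rewrite g'0.
- move=> i A mA; case: (unliftP ord0 i) => [j ->|->].
    rewrite -[LHS]/(P' (g' (lift ord0 j) @^-1` A)) PpreS//.
    exact: norm.
  by rewrite -[LHS]/(P' (g' ord0 @^-1` A)) Ppre0.
- move=> c a; pose f (w : T * R) : R := cos (\sum_i c i * g' i w + a).
  have mcos := continuous_measurable_fun (@continuous_cos R).
  have mf : measurable_fun setT f.
    apply: (measurableT_comp mcos); apply: measurable_funD => //.
    apply: measurable_sum => i; apply: measurable_funM => //.
    exact: (@measurable_funPT _ _ _ _ (g' i)).
  have fM w : `|f w| <= 1 by exact: cos_max.
  have fE x y : f (x, y) = cos (c ord0 * y + (\sum_j c (lift ord0 j) * g j x + a)).
    rewrite /f big_ord_recl g'0 -addrA; congr (cos (_ + (_ + _))).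
    by apply: eq_bigr => j _; rewrite g'S.
  have intf : P'.-integrable setT (EFin \o f) := bounded_integrable P' mf fM.
  rewrite /Rintegral -(integral12_prod_meas1 intf) /fubini_F.
  under eq_integral => x _.
    rewrite (_ : (\int[gauss]_y _)%E = (cos (\sum_j c (lift ord0 j) * g j x + a) *
        expR (- (c ord0 ^+ 2 / 2)))%:E); last first.
      rewrite -normal_cos /Rintegral fineK.
        by apply: eq_integral => y _; rewrite /= fE.
      have mfx : measurable_fun setT (fun y => f (x, y)).
        exact: (measurableT_comp mf).
      have := bounded_integrable gauss mfx (fun y => fM (x, y)).
      move=> /(integrable_fin_num measurableT); congr (_ \is a fin_num).
      by apply: eq_integral => y _; rewrite /= fE.
    over.
  rewrite -/(Rintegral P setT (fun x => cos (\sum_j c (lift ord0 j) * g j x + a) *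
        expR (- (c ord0 ^+ 2 / 2)))).
  rewrite RintegralZr//; last first.
    apply: (bounded_integrable P (M := 1)) => [|x]; last exact: cos_max.
    apply: (measurableT_comp mcos); apply: measurable_funD => //.
    by apply: measurable_sum => i; exact: measurable_funM.
  rewrite char -mulrA -expRD big_ord_recl; congr (_ * expR _).
  by field.
Qed.

End gaussian_family.

(** * The limiting covariance and the law of the sketch *)

Section limit_covariance.
Variables (R : realType) (p : nat).

Lemma vec_pairK (x : 'I_(p * p)) : vec_index (vec_pair x).1 (vec_pair x).2 = x.
Proof.
case/mxvec_indexP: x => j i; rewrite -[mxvec_index j i]/(vec_index i j).
by rewrite vec_indexK.
Qed.

Lemma sum_vec_index (F : 'I_(p * p) -> R) :
  \sum_x F x = \sum_i \sum_j F (vec_index i j).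
Proof.
rewrite pair_bigA /= (reindex (fun ij : 'I_p * 'I_p => vec_index ij.1 ij.2))//=.
exists (@vec_pair p) => [[i j] _|x _] /=; first by rewrite vec_indexK.
exact: vec_pairK.
Qed.

Definition unvec (t : 'cV[R]_(p * p)) : 'M[R]_p := \matrix_(i, j) t (vec_index i j) 0.

Lemma limit_cov_form (t : 'cV[R]_(p * p)) :
  (t^T *m limit_cov R p *m t) 0 0 = goe_var (unvec t).
Proof.
rewrite /limit_cov !mulmxDr !mulmxDl mulmx1 [LHS]mxE [X in X + _ = _]mxE /goe_var.
congr (_ + _ + _).
- rewrite mxE sum_vec_index; apply: eq_bigr => i _; apply: eq_bigr => j _.
  by rewrite !mxE expr2.
- rewrite mxE sum_vec_index; apply: eq_bigr => i _; apply: eq_bigr => j _.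
  rewrite !mxE mulrC; congr (_ * _); rewrite sum_vec_index (bigD1 j)//= (bigD1 i)//=.
  rewrite transp_mxE !eqxx mulr1 [X in _ + X + _]big1 => [|k /negbTE ki].
    rewrite [X in _ + X]big1 ?addr0; [by rewrite mxE|move=> k /negbTE kj].
    rewrite big1// => k' _.
    by rewrite transp_mxE kj mulr0.
  by rewrite transp_mxE ki andbF mulr0.
- rewrite /vec_id_mx mulmxA -mulmxA mxE big_ord1 expr2.
  have e : (t^T *m vec 1%:M) 0 0 = \tr (unvec t).
    rewrite mxE sum_vec_index /mxtrace; apply: eq_bigr => i _.
    rewrite (bigD1 i)//= !mxE vec_indexK /= !eqxx mulr1 big1 ?addr0// => j ji.
    by rewrite !mxE vec_indexK /= eq_sym (negbTE ji) mulr0.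
  congr (_ * _) => //; rewrite -e [LHS]mxE [RHS]mxE.
  by apply: eq_bigr => x _; rewrite !mxE mulrC.
Qed.

Lemma transp_mx_sym : (transp_mx p)^T = transp_mx p :> 'M[R]_(p * p).
Proof. by apply/matrixP => x y; rewrite !mxE andbC eq_sym [X in _ && X]eq_sym. Qed.

Lemma transp_mx_sqr : transp_mx p *m transp_mx p = 1%:M :> 'M[R]_(p * p).
Proof.
apply/matrixP => x y; rewrite -(vec_pairK x) -(vec_pairK y).
case: (vec_pair x) (vec_pair y) => [i j] [k l] /=.
rewrite !mxE sum_vec_index (bigD1 j)//= (bigD1 i)//= !mxE !vec_indexK /= !eqxx mul1r.
rewrite !big1 ?addr0.
- have -> : (vec_index i j == vec_index k l) = (i == k) && (j == l).
    apply/eqP/andP => [/(congr1 (@vec_pair p))|[/eqP-> /eqP->]//].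
    by rewrite !vec_indexK => -[-> ->].
  by rewrite andbC.
- by move=> i' /negbTE i'i; rewrite big1// => j' _; rewrite !mxE !vec_indexK /= (eq_sym j) i'i andbF mul0r.
- by move=> j' /negbTE j'j; rewrite !mxE !vec_indexK /= (eq_sym i) j'j mul0r.
Qed.

(** Transposition is an involution, so the square of [1 + transp_mx] is twice
    itself; the rank one term takes one more column, [vec 1]. *)
Lemma limit_cov_factor : exists A : 'M[R]_(p * p, p * p + 1), A *m A^T = limit_cov R p.
Proof.
exists (row_mx ((Num.sqrt 2)^-1 *: (1%:M + transp_mx p)) (vec 1%:M)).
rewrite tr_row_mx mul_row_col /limit_cov -/(vec_id_mx R p); congr (_ + _).
rewrite linearZ /= -scalemxAl -scalemxAr scalerA linearD /= trmx1 transp_mx_sym.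
rewrite mulmxDl mul1mx mulmxDr mulmx1 transp_mx_sqr [transp_mx p + _]addrC -mulr2n.
rewrite -invfM -expr2 sqr_sqrtr//.
have -> : (1%:M + transp_mx p) *+ 2 = 2 *: (1%:M + transp_mx p) :> 'M[R]_(p * p).
  by rewrite scaler_nat.
by rewrite scalerA mulVf ?scale1r.
Qed.

End limit_covariance.

Section srht_law.
Variables (R : realType) (l m : nat).
Context d (T : measurableType d) (P : probability T R).
Variables (b e : 'I_(2 ^ l) -> {RV P >-> R}).
Notation I := 'I_(2 ^ l).
Let q : R := m%:R / (2 ^ l)%:R.
Hypotheses (q0 : 0 < q) (q1 : q < 1).
Hypothesis indep : mutually_independent
  (fun k : I + I => match k with inl i => b i | inr i => e i end).
Hypothesis b_law : forall i, is_bernoulli q (b i).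
Hypothesis e_law : forall i, is_rademacher (e i).

Lemma srht_expectation (f : T -> R) (F : {ffun I -> bool} -> {ffun I -> bool} -> R) :
  measurable_fun setT f ->
  (forall w (beta eps : {ffun I -> bool}), (forall i, b i w = (beta i)%:R) ->
     (forall i, e i w = sgb R (eps i)) -> f w = F beta eps) ->
  \int[P]_w f w =
  bexp (@fair R I) (fun eps => bexp (fun=> bern_law q) (fun beta => F beta eps)).
Proof.
move=> mf fF; pose A := ({ffun I -> bool} * {ffun I -> bool})%type.
pose x (a : A) (k : I + I) : R := match k with
  | inl i => (a.1 i)%:R | inr i => sgb R (a.2 i) end.
pose wt (a : A) (k : I + I) : R := match k with
  | inl i => bern_law q (a.1 i) | inr i => fair R i (a.2 i) end.
have wtE a : \prod_k wt a k = (\prod_i bern_law q (a.1 i)) * \prod_i fair R i (a.2 i).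
  by rewrite big_sumType.
have sumE (G : {ffun I -> bool} -> {ffun I -> bool} -> R) :
    \sum_a (\prod_k wt a k) * G a.1 a.2 =
    bexp (@fair R I) (fun eps => bexp (fun=> bern_law q) (fun beta => G beta eps)).
  transitivity (\sum_(beta : {ffun I -> bool}) \sum_(eps : {ffun I -> bool}) (\prod_i bern_law q (beta i)) *
      (\prod_(i : I) fair R i (eps i)) * G beta eps).
    by rewrite pair_bigA; apply: eq_bigr => a _; rewrite wtE.
  rewrite exchange_big; apply: eq_bigr => eps _; rewrite big_distrr /=.
  by apply: eq_bigr => beta _; rewrite -mulrA mulrCA.
rewrite /Rintegral (expectation_discrete (K := (I + I)%type) (A := A) (x := x) (wt := wt)
  (F := fun a => F a.1 a.2) indep) /=.
- exact: sumE.
- move=> [b1 e1] [b2 e2] xx; congr pair; apply/ffunP => i.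
    have := xx (inl i); rewrite /x /=.
    by case: (b1 i); case: (b2 i) => //=; lra.
  have := xx (inr i); rewrite /x /= /sgb.
  by case: (e1 i); case: (e2 i) => //=; rewrite expr1 expr0; lra.
- move=> a [i|i] /=.
    by have [h1 h0] := b_law i; rewrite /bern_law; case: (a.1 i).
  have [h1 h0] := e_law i; rewrite /fair /sgb.
  by case: (a.2 i); rewrite ?expr1 ?expr0.
- transitivity (\sum_a (\prod_k wt a k) * 1).
    by apply: eq_bigr => a _; rewrite mulr1.
  rewrite (sumE (fun _ _ => 1)); under eq_bexp do rewrite (bexp1 (bern_bit_law _ q0 q1)).
  exact: (bexp1 (@fair_law R I)).
- exact: mf.
- move=> w a h; apply: fF => i; first exact: (h (inl i)).
  exact: (h (inr i)).
Qed.

End srht_law.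

Section srht_form.
Variables (R : realType) (l p m : nat) (U : 'M[R]_(2 ^ l, p)).
Notation n := (2 ^ l)%N.
Notation I := 'I_(2 ^ l).
Hypotheses (U_orth : U^T *m U = 1%:M) (m0 : (0 < m)%N) (mn : (m < n)%N).
Let q : R := m%:R / n%:R.
Let h := hadamard_sign R l.

Definition srht_error (S : 'M[R]_(2 ^ l)) : 'M[R]_p :=
  U^T *m S^T *m S *m U - 1%:M.

Definition srht_scale : R := Num.sqrt (m%:R / (1 - q)).

(** Orthogonality of the columns of [U] and of the Walsh system writes the
    identity as the mean over all rows of the terms that the selection samples;
    the error is therefore the sum of these terms with centred selection
    variables, which [srht_scale] standardizes. *)
Lemma srht_form (S : 'M[R]_(2 ^ l)) (beta eps : {ffun I -> bool}) (t : 'cV[R]_(p * p)) :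
  S = Num.sqrt (n%:R / m%:R) *:
        (diag_mx (\row_i (beta i)%:R) *m hadamard R l *m diag_mx (\row_i sgb R (eps i))) ->
  cdot t (srht_scale *: vec (srht_error S)) =
  \sum_k had_quad h U (unvec t) k eps / Num.sqrt n%:R * bern_std q (beta k).
Proof.
move=> SE; have n0 : 0 < n%:R :> R by rewrite ltr0n expn_gt0.
have mr0 : 0 < m%:R :> R by rewrite ltr0n.
have q0 : 0 < q by rewrite divr_gt0.
have q1 : q < 1 by rewrite ltr_pdivrMr// mul1r ltr_nat.
have [d hW] := hadamard_sign_walsh R l; rewrite -/h in hW.
pose y k a := had_lin h U k eps a.
have SU k a : (S *m U) k a = (Num.sqrt m%:R)^-1 * ((beta k)%:R * y k a).
  rewrite mxE /y /had_lin !mulr_sumr; apply: eq_bigr => i _.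
  rewrite SE mxE mul_mx_diag mxE mul_diag_mx !mxE sqrtrM ?ler0n// sqrtrV ?ler0n//.
  by ring.
have gram a a' : (U^T *m S^T *m S *m U) a a' =
    \sum_k (m%:R)^-1 * (beta k)%:R * (y k a * y k a').
  rewrite -trmx_mul -mulmxA mxE; apply: eq_bigr => k _.
  rewrite mxE !SU.
  have sm : (Num.sqrt m%:R)^-1 * (Num.sqrt m%:R)^-1 = m%:R^-1 :> R.
    by rewrite -invfM -expr2 sqr_sqrtr// ltW.
  have b2 : (beta k)%:R * (beta k)%:R = (beta k)%:R :> R.
    by case: (beta k); rewrite ?mulr1 ?mulr0.
  by rewrite -sm -[in RHS]b2; ring.
have yy a a' : \sum_k y k a * y k a' = n%:R * (a == a')%:R.
  transitivity (\sum_i \sum_j (\sum_k h k i * h k j) *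
      (U i a * U j a' * (sgb R (eps i) * sgb R (eps j)))).
    under eq_bigr => k _ do rewrite /y /had_lin big_distrlr /=.
    rewrite exchange_big; apply: eq_bigr => i _ /=.
    rewrite exchange_big; apply: eq_bigr => j _ /=.
    by rewrite mulr_suml; apply: eq_bigr => k _; ring.
  have := congr1 (fun A : 'M[R]_p => A a a') U_orth; rewrite !mxE => <-.
  rewrite mulr_sumr; apply: eq_bigr => i _; have [_ orth _] := hW.
  rewrite (bigD1 i)//= [X in _ + X]big1 ?addr0.
    by rewrite orth eqxx mulr1 sgb_sqr mulr1 mxE.
  by move=> j ji; rewrite orth eq_sym (negbTE ji) mulr0 mul0r.
have err a a' : srht_error S a a' =
    \sum_k ((m%:R)^-1 * ((beta k)%:R - q)) * (y k a * y k a').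
  rewrite mxE gram !mxE.
  have -> : (a == a')%:R = \sum_k n%:R^-1 * (y k a * y k a') :> R.
    by rewrite -mulr_sumr yy mulKf// gt_eqF.
  rewrite -sumrB; apply: eq_bigr => k _; rewrite /q.
  by field; rewrite !gt_eqF.
have quadE : cdot t (srht_scale *: vec (srht_error S)) =
    \sum_k srht_scale * ((m%:R)^-1 * ((beta k)%:R - q)) * had_quad h U (unvec t) k eps.
  transitivity (\sum_a \sum_a' \sum_k unvec t a a' * (srht_scale *
     (((m%:R)^-1 * ((beta k)%:R - q)) * (y k a * y k a')))).
    rewrite /cdot sum_vec_index; apply: eq_bigr => a _; apply: eq_bigr => a' _.
    by rewrite [X in _ * X]mxE vecE err mxE !mulr_sumr.
  under eq_bigr => a _ do rewrite exchange_big /=.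
  rewrite exchange_big; apply: eq_bigr => k _ /=; rewrite /had_quad mulr_sumr.
  apply: eq_bigr => a _; rewrite mulr_sumr; apply: eq_bigr => a' _.
  by rewrite -/(y k a) -/(y k a'); ring.
rewrite quadE; apply: eq_bigr => k _; rewrite /bern_std mulrC -!mulrA; congr (_ * _).
have q1' : 0 < 1 - q by rewrite subr_gt0.
have key : srht_scale / m%:R = (Num.sqrt n%:R * bern_sd q)^-1.
  rewrite /srht_scale /bern_sd -sqrtrM ?ler0n//.
  have -> : n%:R * (q * (1 - q)) = m%:R * (1 - q) by rewrite /q; field; rewrite gt_eqF.
  rewrite sqrtrM ?ler0n// sqrtrM ?ler0n// sqrtrV ?(ltW q1')//.
  rewrite -{2}(sqr_sqrtr (ltW mr0)); field.
  by rewrite !gt_eqF ?sqrtr_gt0.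
by rewrite mulrA key invfM -mulrA [X in _ * X]mulrC.
Qed.
End srht_form.

(** * Tails and characteristic functions of the sketching error *)

Section tightness.
Context d (T : measurableType d) (R : realType) (P : probability T R).
Variables (k : nat) (Z : T -> 'cV[R]_k).
Hypothesis mZ : forall c, measurable_fun setT (fun w => Z w c 0).

Lemma box_mono (L L' : R) : L <= L' -> [set w | in_box L (Z w)] `<=` [set w | in_box L' (Z w)].
Proof. by move=> LL w /= h c; rewrite (le_trans (h c)). Qed.

(** The complements of the boxes decrease to the empty set. *)
Lemma random_vector_tight (eps : R) : 0 < eps -> exists L0 : R,
  forall L, L0 <= L -> (P (~` [set w | in_box L (Z w)]) <= eps%:E)%E.
Proof.
move=> e0; pose B (n : nat) := ~` [set w | in_box n%:R (Z w)].
have mB n : measurable (B n) by apply: measurableC; exact: measurable_box.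
have : P (B n) @[n --> \oo] --> P (\bigcap_n B n).
  apply: nonincreasing_cvg_mu => //.
  - by rewrite (le_lt_trans (probability_le1 _ (mB 0%N)))// ltry.
  - exact: bigcap_measurable.
  - move=> n m nm; apply/subsetPset; apply: subsetC.
    by apply: box_mono; rewrite ler_nat.
rewrite (_ : \bigcap_n B n = set0).
  rewrite measure0 => /fine_cvgP[_ /cvgrPdist_le/(_ _ e0)[N _ hN]].
  exists N%:R => L NL; have := hN N (leqnn N).
  rewrite /= sub0r normrN ger0_norm ?fine_ge0// => PN.
  apply: (@le_trans _ _ (P (B N))).
    apply: le_measure; rewrite ?inE//; first by apply: measurableC; exact: measurable_box.
    by apply: subsetC; exact: box_mono.
  by rewrite -(@fineK _ (P (B N))) ?fin_num_measure// lee_fin.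
apply/seteqP; split=> // w h.
have [n hn] : exists n : nat, \sum_c `|Z w c 0| <= n%:R.
  by exists (Num.truncn (\sum_c `|Z w c 0|)).+1; rewrite ltW// truncnS_gt.
apply: (h n I) => c; rewrite (le_trans _ hn)// (bigD1 c)//= lerDl.
by rewrite sumr_ge0.
Qed.

End tightness.

Section gaussian_vector.
Variables (R : realType) (k : nat) (Sigma : 'M[R]_k).

Lemma normal_vector_exists (r : nat) (A : 'M[R]_(k, r)) : A *m A^T = Sigma ->
  exists (d : measure_display) (T : measurableType d) (P : probability T R)
    (Z : T -> 'cV[R]_k),
    [/\ is_normal_vector P Sigma Z,
        forall c, measurable_fun setT (fun w => Z w c 0)
      & forall t a, \int[P]_w cos (cdot t (Z w) + a) =
          cos a * expR (- ((t^T *m Sigma *m t) 0 0 / 2))].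
Proof.
move=> AS; have [d [T [P [g [indep norm char]]]]] := gaussian_family R r.
exists d, T, P, (fun w => A *m \col_i g i w); split.
- by exists r, A, g; split.
- move=> c; under eq_fun do rewrite mxE.
  apply: measurable_sum => i; apply: measurable_funM => //.
  under eq_fun do rewrite mxE; exact: measurable_funPT.
move=> t a; pose u i := \sum_c t c 0 * A c i.
have -> : (t^T *m Sigma *m t) 0 0 = \sum_i u i ^+ 2.
  rewrite -AS !mulmxA -mulmxA mxE; apply: eq_bigr => i _; rewrite expr2; congr (_ * _).
    by rewrite mxE; apply: eq_bigr => c _; rewrite mxE.
  by rewrite mxE; apply: eq_bigr => c _; rewrite mxE mulrC.
rewrite -char; apply: eq_Rintegral => w _; congr (cos (_ + _)).
rewrite /cdot /u; under eq_bigr do rewrite mxE mulr_sumr.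
rewrite exchange_big; apply: eq_bigr => i _; rewrite mulr_suml.
by apply: eq_bigr => c _; rewrite mxE mulrA.
Qed.

End gaussian_vector.

Section srht_estimates.
Variables (R : realType) (l p m : nat) (U : 'M[R]_(2 ^ l, p)).
Context d (T : measurableType d) (P : probability T R) (S : T -> 'M[R]_(2 ^ l)).
Hypothesis S_srht : is_srht P m S.
Let q : R := m%:R / (2 ^ l)%:R.
Let X w : 'cV[R]_(p * p) := srht_scale R l m *: vec (srht_error U (S w)).

Lemma measurable_srht c : measurable_fun setT (fun w => X w c 0).
Proof.
have [b [e [_ _ _ SE]]] := S_srht.
have mS i j : measurable_fun setT (fun w => S w i j).
  under eq_fun do rewrite SE mxE mul_mx_diag mxE mul_diag_mx !mxE.
  by do ![apply: measurable_funM => //].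
have mSU i a : measurable_fun setT (fun w => (S w *m U) i a).
  under eq_fun do rewrite mxE.
  by apply: measurable_sum => j; exact: measurable_funM.
rewrite /X; under eq_fun do rewrite mxE [vec _ _ _]mxE /srht_error mxE -trmx_mul -mulmxA mxE.
apply: measurable_funM => //; apply: measurable_funD; last exact: measurable_cst.
apply: measurable_sum => j; under eq_fun do rewrite mxE.
exact: measurable_funM.
Qed.

Hypotheses (U_orth : U^T *m U = 1%:M) (m0 : (0 < m)%N) (mn : (m < 2 ^ l)%N).
Variable eta : R.
Hypothesis eta_le : forall i, \sum_a U i a ^+ 2 <= eta.

Let n0 : (0 < 2 ^ l)%N. Proof. by rewrite expn_gt0. Qed.
Let q0 : 0 < q. Proof. by rewrite divr_gt0 ?ltr0n. Qed.
Let q1 : q < 1. Proof. by rewrite ltr_pdivrMr ?ltr0n// mul1r ltr_nat. Qed.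

Let weight t k eps : R :=
  had_quad (hadamard_sign R l) U (unvec t) k eps / Num.sqrt (2 ^ l)%:R.

(** [F] sees the error only through its scalar products, which is what
    [srht_form] evaluates. A cosine of one scalar product and the indicator of a
    box both have this form. *)
Lemma srht_expectation_form (G : 'cV[R]_(p * p) -> R) :
  measurable_fun setT (G \o X) ->
  forall F : (('cV[R]_(p * p) -> R) -> R),
  (forall x, G x = F (fun t => cdot t x)) ->
  \int[P]_w G (X w) = bexp (@fair R _) (fun eps => bexp (fun=> bern_law q) (fun beta =>
    F (fun t => \sum_k weight t k eps * bern_std q (beta k)))).
Proof.
move=> mG F GF; have [b [e [indep bl el SE]]] := S_srht.
apply: (srht_expectation q0 q1 indep bl el mG) => w beta eps hb he.
rewrite /= GF; congr F; apply/funext => t; apply: srht_form => //.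
rewrite SE; congr (_ *: (_ *m _ *m _)); congr diag_mx; apply/rowP => i; rewrite !mxE.
  exact: hb.
exact: he.
Qed.

Lemma srht_char t a tau : 0 < tau ->
  `|\int[P]_w cos (cdot t (X w) + a) - cos a * expR (- (goe_var (unvec t) / 2))| <=
  3 * ((bern_sd q)^-1 + 1) * (had_moment3 (unvec t) / Num.sqrt (2 ^ l)%:R) +
  (tau + conc_bound (unvec t) eta / tau).
Proof.
move=> tau0; have [dd hW] := hadamard_sign_walsh R l.
have := srht_char_bound (unvec t) hW U_orth n0 q0 q1 eta_le a tau0.
have mX := measurable_srht.
have mG := measurable_trigpoly mX (trigpoly_cos t a).
by rewrite -(srht_expectation_form mG (F := fun f => cos (f t + a))).
Qed.

Definition srht_moment2 : R :=
  \sum_c (goe_var (unvec (delta_mx c 0 : 'cV[R]_(p * p))) + 1 +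
          conc_bound (unvec (delta_mx c 0 : 'cV[R]_(p * p))) eta).

Lemma cdot_delta c (x : 'cV[R]_(p * p)) : cdot (delta_mx c 0) x = x c 0.
Proof.
rewrite /cdot (bigD1 c)//= !mxE !eqxx mul1r big1 ?addr0// => c' /negbTE cc'.
by rewrite !mxE cc' mul0r.
Qed.

(** Chebyshev's inequality in each coordinate. *)
Lemma srht_tail (L : R) : 0 < L ->
  (P (~` [set w | in_box L (X w)]) <= (srht_moment2 / L ^+ 2)%:E)%E.
Proof.
move=> L0; have mX := measurable_srht.
have mB : measurable (~` [set w | in_box L (X w)]).
  by apply: measurableC; exact: measurable_box.
pose bad (f : 'cV[R]_(p * p) -> R) : R := (~~ `[< forall c, `|f (delta_mx c 0)| <= L >])%:R.
pose G (x : 'cV[R]_(p * p)) : R := bad (fun t => cdot t x).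
have GE w : G (X w) = \1_(~` [set w | in_box L (X w)]) w.
  rewrite indicE /G /bad; congr (nat_of_bool _)%:R.
  rewrite in_setC; congr (~~ _); apply/asboolP/idP => [h|].
    by rewrite inE => c; have := h c; rewrite cdot_delta.
  by rewrite inE => h c; rewrite cdot_delta; exact: h.
have mG : measurable_fun setT (G \o X).
  rewrite (_ : G \o X = \1_(~` [set w | in_box L (X w)])); last exact/funext.
  exact: measurable_indic.
have := srht_expectation_form mG (F := bad) (fun=> erefl).
rewrite (_ : \int[P]_w G (X w) = fine (P (~` [set w | in_box L (X w)]))); last first.
  rewrite /Rintegral; under eq_integral do rewrite GE.
  by rewrite integral_indic// setIT.
move=> e; rewrite -(@fineK _ (P _)) ?fin_num_measure// lee_fin e.
have [dd hW] := hadamard_sign_walsh R l.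
have lawe := @fair_law R 'I_(2 ^ l); have lawb := @bern_bit_law R 'I_(2 ^ l) q q0 q1.
apply: (@le_trans _ _ (bexp (@fair R _) (fun eps => bexp (fun=> bern_law q) (fun beta =>
   L ^- 2 * \sum_c (\sum_k weight (delta_mx c 0) k eps * bern_std q (beta k)) ^+ 2)))).
  apply: (le_bexp lawe) => eps; apply: (le_bexp lawb) => beta; rewrite /bad.
  set y := fun t => \sum_k weight t k eps * bern_std q (beta k).
  have S0 : 0 <= \sum_c y (delta_mx c 0) ^+ 2 by apply: sumr_ge0 => c _; exact: sqr_ge0.
  case: asboolP => [_|/existsNP[c /negP]] /=.
    by rewrite mulr_ge0// invr_ge0 exprn_ge0// ltW.
  rewrite -ltNge => Lc; rewrite mulrC ler_pdivlMr ?exprn_gt0// mul1r.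
  apply: (@le_trans _ _ (y (delta_mx c 0) ^+ 2)); last first.
    by rewrite (bigD1 c)//= lerDl sumr_ge0// => c' _; exact: sqr_ge0.
  by rewrite -[leRHS]real_normK ?num_real// lerXn2r ?nnegrE ?(ltW L0) ?(ltW Lc).
under eq_bexp do rewrite bexpZ bexp_sum.
rewrite bexpZ bexp_sum mulrC /srht_moment2 ler_wpM2r ?invr_ge0 ?exprn_ge0 ?(ltW L0)//.
apply: ler_sum => c _.
exact: (srht_second_moment (unvec (delta_mx c 0)) hW U_orth n0 q0 q1 eta_le).
Qed.

End srht_estimates.

(** * Asymptotics of the error terms *)

Section asymptotics.
Variable R : realType.

Lemma conc_bound_cvg p (C : 'M[R]_p) (eta : nat -> R) :
  eta l @[l --> \oo] --> 0 -> conc_bound C (eta l) @[l --> \oo] --> 0.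
Proof.
move=> h; pose K1 := 8 * (abs_sum C ^+ 2 * p%:R) ^+ 2.
pose K2 := 512 * (abs_sum C ^+ 2 * p%:R ^+ 2) * (abs_sum C ^+ 2 * p%:R).
have -> : (fun l => conc_bound C (eta l)) = (fun l => K1 * (eta l * eta l) + K2 * eta l).
  by apply/funext => l; rewrite /conc_bound /K1 /K2; ring.
have -> : 0 = K1 * (0 * 0) + K2 * 0 :> R by rewrite !mulr0 addr0.
apply: cvgD; last by apply: cvgM => //; exact: cvg_cst.
by apply: cvgM; [exact: cvg_cst|exact: cvgM].
Qed.

Lemma had_moment3_ge0 p (C : 'M[R]_p) : 0 <= had_moment3 C.
Proof.
have c0 : 0 <= \sum_a \sum_a' `|C a a'| by apply: sumr_ge0 => a _; apply: sumr_ge0.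
by rewrite /had_moment3 mulr_ge0 ?exprn_ge0// mulr_ge0 ?mulr_ge0 ?exprn_ge0 ?mom6_ge0.
Qed.

(** The standard deviation times [sqrt n] is [sqrt (m (1 - m / n))], so the
    Lyapunov error is of order [m ^ (- 1 / 2)] as long as [m / n] stays away
    from one. *)
Lemma bern_error_le (n m : nat) (kap : R) :
  (0 < m)%N -> (m < n)%N -> 0 < kap -> kap <= 1 - m%:R / n%:R ->
  ((bern_sd (m%:R / n%:R))^-1 + 1) / Num.sqrt n%:R <= 2 / Num.sqrt (m%:R * kap).
Proof.
move=> m0 mn k0 kq; have n0 : (0 < n)%N by apply: leq_ltn_trans mn.
have mr : 0 < m%:R :> R by rewrite ltr0n.
have nr : 0 < n%:R :> R by rewrite ltr0n.
have q0 : 0 <= m%:R / n%:R :> R by rewrite divr_ge0// ler0n.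
have mk : 0 < m%:R * kap by rewrite mulr_gt0.
rewrite mulrDl mul1r -invfM /bern_sd -sqrtrM ?mulr_ge0 ?(le_trans (ltW k0) kq)//.
have -> : m%:R / n%:R * (1 - m%:R / n%:R) * n%:R = m%:R * (1 - m%:R / n%:R) :> R.
  by field; rewrite gt_eqF.
have inv_le (y : R) : m%:R * kap <= y -> (Num.sqrt y)^-1 <= (Num.sqrt (m%:R * kap))^-1.
  move=> h; rewrite lef_pV2 ?posrE ?sqrtr_gt0 ?(lt_le_trans mk h)//.
  by rewrite ler_wsqrtr.
have -> : 2 / Num.sqrt (m%:R * kap) = (Num.sqrt (m%:R * kap))^-1 + (Num.sqrt (m%:R * kap))^-1.
  by rewrite mulr_natl mulr2n.
apply: lerD; apply: inv_le; first by rewrite ler_wpM2l// ltW.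
have k1 : kap <= 1 by rewrite (le_trans kq)// gerBl.
by rewrite (@le_trans _ _ m%:R) ?ler_piMr ?ler_nat// ltnW.
Qed.

Lemma limsup_lt1 (u : nat -> R) : (limn_esup (fun l => (u l)%:E) < 1)%E ->
  exists2 kap : R, 0 < kap & \forall l \near \oo, kap <= 1 - u l.
Proof.
move=> /ereal_inf_lt[s [V V_oo <-] sV].
have [l0 Vl0] := filter_ex V_oo.
have ub l : V l -> ((u l)%:E <= ereal_sup [set (u l)%:E | l in V])%E.
  by move=> Vl; apply: ereal_sup_ubound; exists l.
move: sV ub; case: (ereal_sup _) => [r| |]//; last first.
  by move=> _ /(_ _ Vl0).
rewrite lte_fin => r1 ub; exists (1 - r); first by rewrite subr_gt0.
apply: filterS V_oo => l /ub; rewrite lee_fin => ?; lra.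
Qed.

(** The logarithm is at least [ln 2] as soon as [0 < l]. *)
Lemma sketch_size_large (m : nat -> nat) :
  (m l)%:R / (ln (2 ^ l)%:R) ^+ 2 @[l --> \oo] --> (+oo : set_system R) ->
  forall K : R, \forall l \near \oo, K <= (m l)%:R.
Proof.
move=> h K; pose c : R := ln 2 ^+ 2.
have c0 : 0 < c by rewrite exprn_gt0// ln_gt0// ltr1n.
have K0 : 0 <= Num.max K 0 / c by rewrite divr_ge0 ?le_max ?lexx ?orbT// ltW.
have /cvgryPge/(_ (Num.max K 0 / c)) hK := h.
near=> l.
have l0 : (0 < l)%N by near: l; exists 1%N.
have lnl : c <= ln (2 ^ l)%:R ^+ 2.
  rewrite /c lerXn2r ?nnegrE ?ln_ge0 ?ler1n ?expn_gt0//.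
  rewrite ler_ln ?posrE ?ltr0n ?expn_gt0// ler_nat.
  by rewrite -{1}(expn1 2) leq_exp2l.
have x0 := lt_le_trans c0 lnl.
have : Num.max K 0 / c <= (m l)%:R / ln (2 ^ l)%:R ^+ 2 by near: l.
rewrite ler_pdivlMr// => hm.
rewrite (@le_trans _ _ (Num.max K 0 / c * c))//; last first.
  by rewrite (le_trans _ hm)// ler_wpM2l.
by rewrite divfK ?gt_eqF// le_max lexx.
Unshelve. all: by end_near. Qed.

End asymptotics.

(** * Asymptotic normality *)

Theorem mainTheorem10 (R : realType) (p : nat) (m : nat -> nat)
    (U : forall l : nat, 'M[R]_(2 ^ l, p))
    (d : nat -> measure_display) (T : forall l : nat, measurableType (d l))
    (P : forall l : nat, probability (T l) R)
    (S : forall l : nat, T l -> 'M[R]_(2 ^ l))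
    (m_lt_n : forall l : nat, (m l < 2 ^ l)%N)
    (U_orth : forall l : nat, (p <= 2 ^ l)%N -> (U l)^T *m U l = 1%:M)
    (S_srht : forall l : nat, is_srht (P l) (m l) (S l))
    (U_deloc : \big[Num.max/0]_(i < 2 ^ l) row_norm (U l) i @[l --> \oo] --> (0 : R))
    (m_large : (m l)%:R / (ln (2 ^ l)%:R) ^+ 2 @[l --> \oo] --> (+oo : set_system R))
    (m_limsup : (limn_esup (fun l => ((m l)%:R / (2 ^ l)%:R : R)%:E) < 1)%E) :
  cvg_to_normal P
    (fun (l : nat) (w : T l) =>
       Num.sqrt ((m l)%:R / (1 - (m l)%:R / (2 ^ l)%:R)) *:
         vec ((U l)^T *m (S l w)^T *m S l w *m U l - 1%:M))
    (limit_cov R p).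
Proof.
have [A AA] := limit_cov_factor R p.
have [d' [T' [P' [Z [Z_normal mZ charZ]]]]] := normal_vector_exists AA.
exists d', T', P', Z; split=> //.
pose X l (w : T l) := srht_scale R l (m l) *: vec (srht_error (U l) (S l w)).
have mX l c : measurable_fun setT (fun w => X l w c 0).
  exact: (measurable_srht (U l) (S_srht l)).
pose rho l := \big[Num.max/0]_(i < 2 ^ l) row_norm (U l) i.
pose eta l := rho l ^+ 2.
have eta0 : eta l @[l --> \oo] --> 0.
  by rewrite /eta -(mulr0 (0 : R)); under eq_fun do rewrite expr2; exact: cvgM.
have eta_le l (i : 'I_(2 ^ l)) : \sum_a U l i a ^+ 2 <= eta l.
  have s0 : 0 <= \sum_a U l i a ^+ 2 by apply: sumr_ge0 => a _; exact: sqr_ge0.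
  rewrite -(sqr_sqrtr s0) -/(row_norm (U l) i).
  have rl : row_norm (U l) i <= rho l by exact: le_bigmax.
  by rewrite /eta lerXn2r ?nnegrE ?sqrtr_ge0// (le_trans (sqrtr_ge0 _) rl).
have orth : \forall l \near \oo, (U l)^T *m U l = 1%:M.
  exists p => // l /= pl; apply: U_orth.
  by rewrite (leq_trans pl)// ltnW// ltn_expl.
have m_pos : \forall l \near \oo, (0 < m l)%N.
  have := sketch_size_large m_large 1; apply: filterS => l.
  by rewrite ler1n.
have [kap kap0 hkap] := limsup_lt1 m_limsup.
apply: (@levy_continuity R (p * p) d T P X d' T' P' Z mX mZ).
(* Tightness, from second moments that are bounded because [eta] tends to zero. *)
- move=> eps eps0.
  have mom_cvg : srht_moment2 p (eta l) @[l --> \oo] --> srht_moment2 p (0 : R).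
    apply: cvg_big => [|c _]; first exact: add_continuous.
    apply: cvgD; first exact: cvg_cst.
    have := conc_bound_cvg (unvec (delta_mx c 0 : 'cV[R]_(p * p))) eta0.
    by rewrite /conc_bound !(mulr0, mul0r) expr0n /= mulr0 addr0.
  pose B := srht_moment2 p (0 : R) + 1.
  have momB : \forall l \near \oo, srht_moment2 p (eta l) <= B.
    have := cvgr_le _ mom_cvg; apply; by rewrite /B ltrDl.
  have [L0 hL0] := random_vector_tight P' mZ eps0.
  pose L := Num.max 1 (Num.max L0 (B / eps)).
  have L1 : 1 <= L by rewrite /L le_max lexx.
  have L00 : 0 < L by exact: lt_le_trans L1.
  exists L => //; split; first by apply: hL0; rewrite /L !le_max lexx orbT.
  near=> l.
  have h1 : (U l)^T *m U l = 1%:M by near: l.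
  have h2 : (0 < m l)%N by near: l.
  have h3 : srht_moment2 p (eta l) <= B by near: l.
  have := srht_tail (S_srht l) h1 h2 (m_lt_n l) (eta_le l) L00.
  move/le_trans; apply; rewrite lee_fin ler_pdivrMr ?exprn_gt0//.
  rewrite (le_trans h3)// -ler_pdivrMl// mulrC (@le_trans _ _ L)//.
    by rewrite /L !le_max lexx !orbT.
  by rewrite expr2 ler_peMr// ltW.
(* Convergence of characteristic functions, with three errors of size [tau]. *)
- move=> t a; rewrite charZ limit_cov_form; apply/cvgrPdist_le => eps eps0.
  pose C := unvec t; pose tau := eps / 3.
  have tau0 : 0 < tau by rewrite divr_gt0.
  have conc_small : \forall l \near \oo, conc_bound C (eta l) <= tau * tau.
    have := cvgr_le _ (conc_bound_cvg C eta0); apply.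
    by rewrite mulr_gt0.
  pose K := (6 * had_moment3 C / tau) ^+ 2 / kap.
  have m_big := sketch_size_large m_large K.
  near=> l.
  have h1 : (U l)^T *m U l = 1%:M by near: l.
  have h2 : (0 < m l)%N by near: l.
  have h3 : K <= (m l)%:R by near: l.
  have h4 : conc_bound C (eta l) <= tau * tau by near: l.
  have h5 : kap <= 1 - (m l)%:R / (2 ^ l)%:R by near: l.
  rewrite distrC.
  rewrite (le_trans (srht_char (S_srht l) h1 h2 (m_lt_n l) (eta_le l) t a tau0))//.
  have e1 : conc_bound C (eta l) / tau <= tau by rewrite ler_pdivrMr.
  have mom0 := had_moment3_ge0 C.
  have mk : 0 < (m l)%:R * kap by rewrite mulr_gt0// ltr0n.
  have e2 : 6 * had_moment3 C / tau <= Num.sqrt ((m l)%:R * kap).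
    have x0 : 0 <= 6 * had_moment3 C / tau by apply: divr_ge0; [exact: mulr_ge0|exact: ltW].
    rewrite -[leLHS](ger0_norm x0).
    by rewrite -sqrtr_sqr ler_wsqrtr// -ler_pdivrMr.
  have e3 : 3 * ((bern_sd ((m l)%:R / (2 ^ l)%:R))^-1 + 1) *
      (had_moment3 C / Num.sqrt (2 ^ l)%:R) <= tau.
    have := bern_error_le h2 (m_lt_n l) kap0 h5.
    set E := (_ + 1) / _ => hE.
    have -> : 3 * ((bern_sd ((m l)%:R / (2 ^ l)%:R))^-1 + 1) *
      (had_moment3 C / Num.sqrt (2 ^ l)%:R) = 3 * had_moment3 C * E by rewrite /E; ring.
    apply: (@le_trans _ _ (3 * had_moment3 C * (2 / Num.sqrt ((m l)%:R * kap)))).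
      by rewrite ler_wpM2l// mulr_ge0.
    have -> : 3 * had_moment3 C * (2 / Num.sqrt ((m l)%:R * kap)) =
      6 * had_moment3 C / Num.sqrt ((m l)%:R * kap) by ring.
    by rewrite ler_pdivrMr ?sqrtr_gt0// [leRHS]mulrC -ler_pdivrMr.
  have -> : eps = tau + (tau + tau) by rewrite /tau; field.
  by apply: lerD => //; apply: lerD.
Unshelve. all: by end_near. Qed.
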